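(* Let $\mathfrak g$ be a $2$-step solvable Lie algebra endowed with a complex structure $J$ and suppose that $2\notin \mathrm{Spec}(\mathrm{ad}_{JU}|_{\mathfrak g'_J})$, where $JU$ is the mean curvature vector of $\mathfrak g$. Then there exists a unique $J$-semisimple subalgebra $\mathfrak h$ of $\mathfrak g$ such that $$\mathfrak g=\mathfrak h\ltimes \mathrm{Rad}(\mathfrak g,J).$$
   Context: All Lie algebras are finite-dimensional and real. A complex structure on $\mathfrak g$ is $J\in\mathrm{End}(\mathfrak g)$ with $J^2=-\mathrm{Id}$ and $[X,Y]+J[JX,Y]+J[X,JY]-[JX,JY]=0$ for all $X,Y$; it is abelian if $[JX,JY]=[X,Y]$ for all $X,Y$. Write $\mathfrak g'=[\mathfrak g,\mathfrak g]$ and $\mathfrak g'_J=\mathfrak g'\cap J\mathfrak g'$. $2$-step solvable means $[\mathfrak g',\mathfrak g']=0$. The $J$-adapted derived series is $\mathfrak g^{[0]}(J)=\mathfrak g$, $\mathfrak g^{[j+1]}(J)=[\mathfrak g^{[j]}(J),\mathfrak g^{[j]}(J)]+J[\mathfrak g^{[j]}(J),\mathfrak g^{[j]}(J)]$. $\mathfrak g$ is $J$-solvable if $\mathfrak g^{[j]}(J)=0$ for some $j$ (the notion applies to $J$-invariant subalgebras and ideals). $\mathrm{Rad}(\mathfrak g,J)$ is the maximal $J$-solvable ideal of $\mathfrak g$. A Lie algebra with complex structure (in particular a $J$-invariant subalgebra) is $J$-semisimple if it has no non-zero $J$-solvable ideals; the zero algebra is allowed. $\mathfrak g=\mathfrak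 h\ltimes\mathfrak k$ means that $\mathfrak h$ is a $J$-invariant subalgebra, $\mathfrak k$ a $J$-invariant ideal, and $\mathfrak g=\mathfrak h\oplus\mathfrak k$ as vector spaces. Mean curvature vector. If $\mathfrak g$ is $2$-step solvable, $\mathfrak g'_J$ is a $J$-invariant abelian ideal of $\mathfrak g'+J\mathfrak g'$ and the quotient $\mathfrak q=(\mathfrak g'+J\mathfrak g')/\mathfrak g'_J$ carries an abelian complex structure. For a Lie algebra with abelian complex structure there is a unique $J$-semisimple subalgebra complementary to the $J$-solvable radical; let $\mathfrak h_{\mathfrak q}$ be this subalgebra of $\mathfrak q$. A Lie algebra with semisimple abelian complex structure is (uniquely up to order) a direct sum of $J$-invariant ideals, each isomorphic as a Lie algebra with complex structure either to $\mathfrak{aff}(\mathbb R)=\langle X,JX\rangle$ with $[JX,X]=X$, or to $\mathfrak{aff}(\mathbb C)=\langle X,JX,Y,JY\rangle$ with $[JX,X]=X$, $[JX,Y]=[JY,X]=Y$, $[JY,Y]=-X$, $[X,Y]=[JX,JY]=0$. Let $s$ be the involution of $\mathfrak h_{\mathfrak q}$ equal to $-\mathrm{Id}$ on the span of the vectors $Y,JY$ of the $\mathfrak{aff}(\mathbb C)$ summands and to $\mathrm{Id}$ on the $\mathfrak{aff}(\mathbb R)$ summands and on the vectors $X,JX$ of the $\mathfrak{aff}(\mathbb C)$ summands. Let $B$ be the Killing form of $\mathfrak h_{\mathfrak q}$, $B^{1,1}(V,W)=\frac12(B(V,W)+B(JV,JW))$ and $B^{1,1}_s(V,W)=B^{1,1}(V,sW)$,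 which is positive definite. The mean curvature vector $JU\in\mathfrak h_{\mathfrak q}$ is defined by $\mathrm{tr}(\mathrm{ad}^{\mathfrak h_{\mathfrak q}}_V)=B^{1,1}_s(JU,V)$ for all $V\in\mathfrak h_{\mathfrak q}$. One also denotes by $JU$ any representative in $\mathfrak g'+J\mathfrak g'$ and calls it the mean curvature vector of $\mathfrak g$; since $\mathfrak g'_J$ is abelian, $\mathrm{ad}_{JU}|_{\mathfrak g'_J}\in\mathrm{End}(\mathfrak g'_J)$ does not depend on the representative. $\mathrm{Spec}$ denotes the set of complex eigenvalues. *)

(* Defs.v *)
From HB Require Import structures.
From mathcomp Require Import all_boot all_order all_algebra.
From mathcomp Require Import boolp classical_sets reals.
From mathcomp Require Import complex.

Set Implicit Arguments.
Unset Strict Implicit.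
Unset Printing Implicit Defensive.

Import Order.TTheory GRing.Theory Num.Theory.

Local Open Scope classical_set_scope.
Local Open Scope ring_scope.
Local Open Scope complex_scope.

(* A finite-dimensional real Lie algebra with complex structure is a space    *)
(* V : vectType R, R : realType, with a bracket br : V -> V -> V and an       *)
(* endomorphism J : 'End(V).  The axioms are the separate predicates          *)
(* lie_bracket and complex_structure, so that restrictions and quotients are  *)
(* definable before one knows that they inherit the axioms.                   *)

Section Endomorphisms.
Variables (R : realType) (V : vectType R).

Definition endo_mx (f : 'End(V)) : 'M[R]_(\dim {:V}) :=
  passmx.mxof (vbasis {:V}) (vbasis {:V}) f.

Definition lftrace (f : 'End(V)) : R := \tr (endo_mx f).

Definition Spec (f : 'End(V)) : set R[i] :=
  [set z | eigenvalue (map_mx (real_complex R) (endo_mx f)) z].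

(* Meaningful when f maps W into itself; vsproj W is a retraction of vsval.   *)
Definition restr_end (W : {vspace V}) (f : 'End(V)) : 'End(subvs_of W) :=
  linfun (vsproj W \o f \o vsval).

End Endomorphisms.

Section LieAlgebra.
Variables (R : realType) (V : vectType R).
Variables (br : V -> V -> V) (J : 'End(V)).

Record lie_bracket : Prop := LieBracket {
  lie_linearl : forall y, linear (br^~ y);
  lie_linearr : forall x, linear (br x);
  lie_alt : forall x, br x x = 0;
  lie_jacobi : forall x y z, br x (br y z) + br y (br z x) + br z (br x y) = 0
}.

Record complex_structure : Prop := ComplexStructure {
  cplx_sqr : forall x, J (J x) = - x;
  cplx_integrable : forall x y,
    br x y + J (br (J x) y) + J (br x (J y)) - br (J x) (J y) = 0
}.

(* linfun (br x) agrees with br x as soon as br x is linear.                  *)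
Definition ad (x : V) : 'End(V) := linfun (br x).

(* By bilinearity, brackets of basis vectors span the span of all [x, y] with *)
(* x in U and y in W.                                                         *)
Definition lie_span (U W : {vspace V}) : {vspace V} :=
  <<allpairs br (vbasis U) (vbasis W)>>%VS.

Definition derived : {vspace V} := lie_span fullv fullv.

Definition two_step_solvable : Prop := lie_span derived derived = 0%VS.

Definition J_invariant (U : {vspace V}) : Prop := (J @: U <= U)%VS.

Definition J_subalgebra (h : {vspace V}) : Prop :=
  (lie_span h h <= h)%VS /\ J_invariant h.

Definition J_ideal (h k : {vspace V}) : Prop :=
  [/\ (k <= h)%VS, (lie_span h k <= k)%VS & J_invariant k].

Definition J_derived (U : {vspace V}) : {vspace V} :=
  (lie_span U U + J @: lie_span U U)%VS.

Definition J_solvable (U : {vspace V}) : Prop :=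
  exists j : nat, iter j J_derived U = 0%VS.

Definition J_semisimple (h : {vspace V}) : Prop :=
  J_subalgebra h /\
  forall k : {vspace V}, J_ideal h k -> J_solvable k -> k = 0%VS.

Definition is_J_radical (r : {vspace V}) : Prop :=
  [/\ J_ideal fullv r, J_solvable r
    & forall k, J_ideal fullv k -> J_solvable k -> (k <= r)%VS].

Definition Rad : {vspace V} := xget 0%VS [set r | is_J_radical r].

Definition semidirect (h k : {vspace V}) : Prop :=
  [/\ J_subalgebra h, J_ideal fullv k,
      (h + k)%VS = fullv & (h :&: k)%VS = 0%VS].

(* Unique when J is an abelian complex structure.                             *)
Definition J_levi : {vspace V} :=
  xget 0%VS [set h | J_semisimple h /\ semidirect h Rad].

Definition derivedJ : {vspace V} := (derived :&: J @: derived)%VS.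

Definition derived_plus : {vspace V} := (derived + J @: derived)%VS.

Definition killing (x y : V) : R := lftrace (ad x \o ad y)%VF.

Definition killing11 (x y : V) : R :=
  2^-1 * (killing x y + killing (J x) (J y)).

Definition aff_R_frame (I : {vspace V}) (X : V) : Prop :=
  basis_of I [:: X; J X] /\ br (J X) X = X.

Definition aff_C_frame (I : {vspace V}) (X Y : V) : Prop :=
  [/\ basis_of I [:: X; J X; Y; J Y],
      br (J X) X = X,
      br (J X) Y = Y /\ br (J Y) X = Y,
      br (J Y) Y = - X
    & br X Y = 0 /\ br (J X) (J Y) = 0].

Definition is_aff_involution (s : 'End(V)) : Prop :=
  exists (n : nat) (I : 'I_n -> {vspace V}),
    [/\ directv (\sum_(i < n) I i)%VS,
        (\sum_(i < n) I i)%VS = fullv,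
        forall i, J_ideal fullv (I i)
      & forall i,
          (exists X : V,
             [/\ aff_R_frame (I i) X, s X = X & s (J X) = J X])
          \/
          (exists X Y : V,
             [/\ aff_C_frame (I i) X Y, s X = X, s (J X) = J X,
                 s Y = - Y & s (J Y) = - J Y])].

Definition aff_involution : 'End(V) := xget 0 [set s | is_aff_involution s].

Definition killing11s (x y : V) : R := killing11 x (aff_involution y).

(* The mean curvature vector of a Lie algebra whose complex structure is      *)
(* abelian and semisimple.                                                    *)
Definition mean_curvature_ss : V :=
  xget 0 [set u | forall v, lftrace (ad v) = killing11s u v].

End LieAlgebra.

Section Subalgebra.
Variables (R : realType) (V : vectType R).
Variables (br : V -> V -> V) (J : 'End(V)) (h : {vspace V}).

Definition sub_br (x y : subvs_of h) : subvs_of h :=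
  vsproj h (br (vsval x) (vsval y)).

Definition sub_J : 'End(subvs_of h) := restr_end h J.

End Subalgebra.

Section Quotient.
Variables (R : realType) (V : vectType R).
Variables (br : V -> V -> V) (J : 'End(V)) (K I : {vspace V}).

(* The quotient K / I of a subalgebra K by an ideal I is carried by the       *)
(* library's complement K :\: I of I in K (any complement gives an isomorphic *)
(* result); quot_proj restricted to K is the canonical projection, with       *)
(* kernel I.                                                                  *)
Definition quot : vectType R := subvs_of (K :\: I)%VS.

Definition quot_proj (x : V) : quot :=
  vsproj (K :\: I)%VS (daddv_pi (K :\: I) I x).

Definition quot_br (x y : quot) : quot := quot_proj (br (vsval x) (vsval y)).

Definition quot_J : 'End(quot) := linfun (quot_proj \o J \o vsval).

End Quotient.

Section MeanCurvature.
Variables (R : realType) (V : vectType R).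
Variables (br : V -> V -> V) (J : 'End(V)).

Let K : {vspace V} := derived_plus br J.
Let I : {vspace V} := derivedJ br J.
Let qbr := @quot_br R V br K I.
Let qJ := quot_J J K I.
Let hq := J_levi qbr qJ.

(* JU is a representative in K = g' + Jg' of the vector of hq that K / g'_J   *)
(* determines; representatives differ by elements of g'_J.                    *)
Definition is_mean_curvature (JU : V) : Prop :=
  JU \in K /\
  quot_proj K I JU = vsval (mean_curvature_ss (@sub_br R _ qbr hq) (sub_J qJ hq)).

End MeanCurvature.

(* Main.v *)
Require Import Defs.
From HB Require Import structures.
From mathcomp Require Import all_boot all_order all_algebra.
From mathcomp Require Import boolp classical_sets reals.
From mathcomp Require Import complex ring.

Set Implicit Arguments.
Unset Strict Implicit.
Unset Printing Implicit Defensive.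

Import Order.TTheory GRing.Theory Num.Theory.
Import passmx.

Local Open Scope ring_scope.
Local Open Scope complex_scope.

(* Write m x y = [J x, y], D = g' and I = g'_J.  Modulo I, m is a commutative
   associative product on D, and 2-step solvability makes all operators ad z
   commute on D.  The mean curvature vector is 2 J e modulo I, where e is the
   unit of the semisimple part of D / I: on a semisimple affine algebra with
   unit e the Killing form satisfies B (J e) w = tr (ad w), and the involution
   s is an automorphism.  The spectral hypothesis thus says that m e - 1 is
   invertible on I, so e lifts to an idempotent of D and the eigenspace G of
   m e for the eigenvalue 1 meets I trivially.  Hence G is an honest commutative
   unital algebra, stable under ad g, and z |-> [z, e] is a map to G for which
   z |-> J [z, e] + [J z, e] retracts g onto the subalgebra G + J G.
   The radical is the set of z for which [z, e] and [J z, e] are nilpotent in G,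
   and h = S + J S where G = S + nilpotents is the Wedderburn decomposition.
   For another complement h', the projection to h' along the radical is
   multiplicative and congruent to the identity modulo nilpotents; it therefore
   fixes e, then the idempotents and square roots of minus idempotents that
   span S, so h' = h. *)

(** The obstacle is a one-sided failure of [m] to be an algebra on [D]: [m x y = 0] for [x] in [I],
    but for [y] in [I] the product only lands in [I]. An idempotent modulo [I] is therefore
    corrected by an [i] in [I] with [m e i - i = m e e - e], and this can be solved because 1 is not
    an eigenvalue of [m e] on [I]. The constant 2 comes from the averaging in B^{1,1}: the term B(J
    J e, J w) vanishes, so [J e] yields only half of tr (ad w), and the mean curvature vector is 2 J
    e. Eigenvalue 2 of its action on [I] is thus eigenvalue 1 of [m e]. The structure theorem for a
    given idempotent is used twice: on the algebra itself, and before that on (g' + J g') / I, where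
    it identifies the subalgebra hidden in the definition of the mean curvature vector. *)

Section SubspaceChains.
Variables (K : fieldType) (V : vectType K).

Lemma stable_iter (F : {vspace V} -> {vspace V}) (U : {vspace V}) :
  (forall j, iter j.+1 F U <= iter j F U)%VS ->
  exists j, iter j.+1 F U = iter j F U.
Proof.
move=> Fdecr; apply: contrapT => /forallNP Fneq.
have dim_lt j : (\dim (iter j F U) + j <= \dim U)%N.
  elim: j => [|j IHj]; first by rewrite addn0.
  apply: leq_trans IHj; rewrite addnS ltn_add2r ltn_neqAle (dimvS (Fdecr j)).
  by rewrite (dimv_leqif_eq (Fdecr j)) andbT; apply/eqP/Fneq.
have := dim_lt (\dim U).+1.
by rewrite addnS ltnNge leq_addl.
Qed.

(** Take a subspace of maximal dimension among those contained in [P]; adding the line of any [x]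
    with [P x] cannot enlarge it. *)
Lemma vspace_of_pred (P : V -> Prop) :
  P 0 -> (forall a x y, P x -> P y -> P (a *: x + y)) ->
  exists U : {vspace V}, forall x, (x \in U) <-> P x.
Proof.
move=> P0 PD.
pose Q k := `[< exists U : {vspace V}, \dim U = k /\ forall x, x \in U -> P x >].
have exQ : exists k, Q k.
  exists 0; apply/asboolP; exists 0%VS; split; first exact: dimv0.
  by move=> x; rewrite memv0 => /eqP ->.
have ubQ k : Q k -> (k <= \dim {:V})%N.
  by case/asboolP => U [<- _]; apply: dimvS; apply: subvf.
case: (ex_maxnP exQ ubQ) => k /asboolP[U [dimU UP]] maxk.
exists U => x; split=> [/UP //|Px].
have /maxk : Q (\dim (U + <[x]>)%VS).
  apply/asboolP; exists (U + <[x]>)%VS; split=> // z.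
  case/memv_addP => u /UP Pu [_ /vlineP[a ->] ->]; rewrite addrC; exact: PD.
rewrite -dimU (geq_leqif (dimv_leqif_sup (addvSl _ _))) subv_add subvv /=.
by rewrite -memvE.
Qed.

Lemma inj_stable_limg (f : 'End(V)) (U : {vspace V}) :
  (f @: U <= U)%VS -> (forall x, x \in U -> f x = 0 -> x = 0) -> (f @: U)%VS = U.
Proof.
move=> fU f_inj; apply/eqP; rewrite eqEdim fU limg_dim_eq ?leqnn //.
apply/eqP; rewrite -subv0; apply/subvP => x /memv_capP[Ux].
by rewrite memv_ker memv0 => /eqP/f_inj->.
Qed.

End SubspaceChains.

(** * Real quadratic factors of an endomorphism *)

Section RealEigen.
Variable R : realType.

(** A complex root a + ib of the characteristic polynomial makes the real matrix (M - a)^2 + b^2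
    singular over the complex numbers. Its determinant is real, so it already has a real kernel
    vector. *)
Lemma real_quadratic_factor n (M : 'M[R]_n) : (0 < n)%N ->
  exists a b (v : 'rV_n),
    v != 0 /\ v *m M *m M - (a + a) *: (v *m M) + (a ^+ 2 + b ^+ 2) *: v = 0.
Proof.
case: n M => // n M _; pose f := real_complex R; pose Mc := map_mx f M.
have /closed_rootP[z] : size (char_poly Mc) != 1%N by rewrite size_char_poly.
rewrite -eigenvalue_root_char => /eigenvalueP[w wM w0].
pose a := complex.Re z; pose b := complex.Im z.
have zE : z = a +i* b by rewrite /a /b; case: (z).
pose N := M *m M - (a + a) *: M + (a ^+ 2 + b ^+ 2)%:M.
have wN : w *m map_mx f N = 0.
  rewrite /N map_mxD map_mxB map_mxM map_mxZ map_scalar_mx -/Mc.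
  rewrite mulmxDr mulmxBr mulmxA wM -scalemxAl wM -scalemxAr wM mul_mx_scalar.
  rewrite !scalerA -scalerBl -scalerDl [X in X *: _](_ : _ = 0) ?scale0r // zE.
  apply/eqP; rewrite eq_complex /f /= !(mul0r, mulr0, subr0, addr0, oppr0).
  by apply/andP; split; apply/eqP; ring.
have : \det N == 0.
  rewrite -(fmorph_eq0 f) -det_map_mx; apply/det0P; by exists w.
case/det0P => v v0 vN; exists a, b, v; split=> //.
by move: vN; rewrite /N mulmxDr mulmxBr mulmxA -scalemxAr mul_mx_scalar.
Qed.

Lemma lfun_quadratic_factor (V : vectType R) (B : {vspace V}) (f : 'End(V)) :
  B != 0%VS -> (f @: B <= B)%VS ->
  exists a b x, [/\ x \in B, x != 0 &
    f (f x) - (a + a) *: f x + (a ^+ 2 + b ^+ 2) *: x = 0].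
Proof.
move=> B0 fB.
have fBx x : x \in B -> f x \in B by move=> Bx; apply/(subvP fB)/memv_img.
pose g : 'End(subvs_of B) := linfun (vsproj B \o f \o vsval).
have gE x : vsval (g x) = f (vsval x).
  by rewrite lfunE /= vsprojK // fBx // subvsP.
pose e := vbasis {:subvs_of B}.
have eP : basis_of {:subvs_of B} e by exact: vbasisP.
have dimB : (0 < \dim {:subvs_of B})%N by rewrite dimvf lt0n dimv_eq0.
have [a [b [v [v0 vM]]]] := real_quadratic_factor (mxof e e g) dimB.
pose w := vecof e v.
have vE : v = rVof e w by rewrite vecofK.
have w0 : w != 0 by rewrite vecof_eq0.
exists a, b, (vsval w); split; first exact: subvsP.
  by apply: contraNneq w0 => w0; apply/eqP/subvs_inj; rewrite w0 linear0.
rewrite {1 2 3}vE -!rVof_app // -!linearZ -linearB -linearD in vM.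
move/eqP: vM; rewrite rVof_eq0 // => /eqP/(congr1 vsval).
by rewrite linearD linearB !linearZ /= !gE.
Qed.

End RealEigen.

(** * Finite-dimensional commutative algebras *)

Record bilin (K : fieldType) (V : vectType K) (m : V -> V -> V) : Prop := Bilin {
  bilinl : forall y, linear (m^~ y);
  bilinr : forall x, linear (m x)
}.

Section Bilinear.
Variables (K : fieldType) (V : vectType K) (m : V -> V -> V).
Hypothesis mbil : bilin m.

Lemma bDl x y z : m (x + y) z = m x z + m y z.
Proof. by have := bilinl mbil z 1 x y; rewrite !scale1r. Qed.

Lemma bDr x y z : m x (y + z) = m x y + m x z.
Proof. by have := bilinr mbil x 1 y z; rewrite !scale1r. Qed.

Lemma b0l x : m 0 x = 0.
Proof. by apply: (@addIr _ (m 0 x)); rewrite -bDl !add0r. Qed.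

Lemma b0r x : m x 0 = 0.
Proof. by apply: (@addIr _ (m x 0)); rewrite -bDr !add0r. Qed.

Lemma bZl a x y : m (a *: x) y = a *: m x y.
Proof. by have := bilinl mbil y a x 0; rewrite addr0 b0l addr0. Qed.

Lemma bZr a x y : m x (a *: y) = a *: m x y.
Proof. by have := bilinr mbil x a y 0; rewrite addr0 b0r addr0. Qed.

Lemma bNl x y : m (- x) y = - m x y.
Proof. by rewrite -scaleN1r bZl scaleN1r. Qed.

Lemma bNr x y : m x (- y) = - m x y.
Proof. by rewrite -scaleN1r bZr scaleN1r. Qed.

Lemma bBl x y z : m (x - y) z = m x z - m y z.
Proof. by rewrite bDl bNl. Qed.

Lemma bBr x y z : m x (y - z) = m x y - m x z.
Proof. by rewrite bDr bNr. Qed.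

Lemma bsuml I (r : seq I) P (F : I -> V) y :
  m (\sum_(i <- r | P i) F i) y = \sum_(i <- r | P i) m (F i) y.
Proof. by apply: (big_morph (m^~ y) (fun u v => bDl u v y) (b0l y)). Qed.

Lemma bsumr I (r : seq I) P (F : I -> V) x :
  m x (\sum_(i <- r | P i) F i) = \sum_(i <- r | P i) m x (F i).
Proof. by apply: (big_morph (m x) (bDr x) (b0r x)). Qed.

Definition lmul x : 'End(V) := linfun (m x).

Lemma lmulE x y : lmul x y = m x y.
Proof.
pose mx := GRing.isLinear.Build K V V *:%R (m x) (bilinr mbil x).
pose mxL : {linear V -> V} := HB.pack (m x) mx.
by rewrite /lmul -[m x]/(mxL : V -> V) lfunE.
Qed.

End Bilinear.


Definition sq (T : Type) (m : T -> T -> T) (x : T) := m x x.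

(** Repeated squaring replaces powers: it makes sense without associativity, hence also on [D],
    where [m] is associative only modulo [I]. *)
Definition nilp (K : fieldType) (V : vectType K) (m : V -> V -> V) (x : V) :=
  exists j, iter j (sq m) x = 0.

Record calg (K : fieldType) (V : vectType K) (m : V -> V -> V) (B : {vspace V}) :
  Prop := CAlg {
  calg_bil : bilin m;
  calg_closed : forall x y, x \in B -> y \in B -> m x y \in B;
  calg_comm : forall x y, x \in B -> y \in B -> m x y = m y x;
  calg_assoc : forall x y z, x \in B -> y \in B -> z \in B ->
    m x (m y z) = m (m x y) z
}.

Section CommutativeAlgebra.
Variables (K : fieldType) (V : vectType K) (m : V -> V -> V) (B : {vspace V}).
Hypothesis mB : calg m B.

Let bil := calg_bil mB.
Local Notation "x ** y" := (m x y) (at level 40, left associativity).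
Local Notation nil := (nilp m).
Local Notation sq := (sq m).

Lemma mcl x y : x \in B -> y \in B -> x ** y \in B.
Proof. exact: calg_closed. Qed.

Local Ltac memB := first [ assumption | lazymatch goal with
  | |- is_true (in_mem (m _ _) _) => apply: mcl; memB
  | |- is_true (in_mem (_ + _) _) => apply: memvD; memB
  | |- is_true (in_mem (- _) _) => rewrite memvN; memB
  | |- is_true (in_mem (_ *: _) _) => apply: memvZ; memB
  | |- is_true (in_mem 0 _) => exact: mem0v
  end ].
Local Hint Extern 0 (is_true (in_mem _ _)) => memB : core.

Lemma mC x y : x \in B -> y \in B -> x ** y = y ** x.
Proof. exact: calg_comm. Qed.

Lemma mA x y z : x \in B -> y \in B -> z \in B -> x ** (y ** z) = (x ** y) ** z.
Proof. exact: calg_assoc. Qed.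

Lemma mCA x y z : x \in B -> y \in B -> z \in B -> x ** (y ** z) = y ** (x ** z).
Proof. by move=> xB yB zB; rewrite !mA // (mC xB). Qed.

Lemma mAC x y z : x \in B -> y \in B -> z \in B -> x ** y ** z = x ** z ** y.
Proof. by move=> xB yB zB; rewrite -!mA // (mC yB). Qed.

Lemma mACA x y z t : x \in B -> y \in B -> z \in B -> t \in B ->
  (x ** y) ** (z ** t) = (x ** z) ** (y ** t).
Proof. by move=> xB yB zB tB; rewrite !mA // (mAC xB). Qed.

Lemma iter_sq_cl j x : x \in B -> iter j sq x \in B.
Proof. by move=> xB; elim: j => //= j IHj; apply: mcl. Qed.

Lemma iter_sqM j x y : x \in B -> y \in B ->
  iter j sq (x ** y) = iter j sq x ** iter j sq y.
Proof.
by move=> xB yB; elim: j => //= j ->; rewrite {1}/sq mACA //; exact: iter_sq_cl.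
Qed.

Lemma nilp_sq x : nil (x ** x) <-> nil x.
Proof.
split=> -[j xj]; first by exists j.+1; rewrite iterSr.
by exists j; rewrite -[x ** x]/(sq x) -iterSr /= xj /sq (b0l bil).
Qed.

Lemma nilpMl x y : x \in B -> y \in B -> nil x -> nil (x ** y).
Proof. by move=> xB yB [j xj]; exists j; rewrite iter_sqM // xj (b0l bil). Qed.

Lemma nilpMr x y : x \in B -> y \in B -> nil y -> nil (x ** y).
Proof. by move=> xB yB; rewrite mC //; apply: nilpMl. Qed.

Lemma nilpZ a x : nil x -> nil (a *: x).
Proof.
case=> j; elim: j a x => [|j IHj] a x /=; first by move=> ->; exists 0; rewrite /= scaler0.
rewrite -iterS iterSr => /(IHj (a ^+ 2)) ?; apply/nilp_sq.
by rewrite (bZl bil) // (bZr bil) // scalerA -expr2.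
Qed.

Lemma nilpN x : nil x -> nil (- x).
Proof. by rewrite -scaleN1r; apply: nilpZ. Qed.

(* With [sq x] of lower level than [x]: (x + y)^2 = x^2 + y (2x + y). *)
Lemma nilpD x y : x \in B -> y \in B -> nil x -> nil y -> nil (x + y).
Proof.
move=> xB yB [j]; elim: j x y xB yB => [|j IHj] x y xB yB /=.
  by move=> ->; rewrite add0r.
rewrite -iterS iterSr => xj yn; apply/nilp_sq.
rewrite (bDl bil) !(bDr bil) -addrA; apply: IHj => //.
rewrite addrA (mC xB) // -!(bDr bil) //; exact: nilpMl.
Qed.

Lemma nilpB x y : x \in B -> y \in B -> nil x -> nil y -> nil (x - y).
Proof. by move=> xB yB xn yn; apply: nilpD; rewrite ?memvN //; apply: nilpN. Qed.

Lemma nilp_idem f : f ** f = f -> nil f -> f = 0.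
Proof. by move=> ff [j <-]; elim: j => //= j <-. Qed.

(** Substituting the equation into itself gives n = n t^(2^j) for every [j]. *)
Lemma fixed_by_nilp n t : n \in B -> t \in B -> n = n ** t -> nil t -> n = 0.
Proof.
move=> nB tB nt [j tj]; have : n = n ** iter j sq t.
  elim: j {tj} => //= j IHj.
  by rewrite {1}IHj {1}IHj -mA //; apply: iter_sq_cl.
by rewrite tj (b0r bil).
Qed.

(** The difference d of two commuting idempotents satisfies d = d^3, so it is fixed by the nilpotent
    d^2. *)
Lemma idem_eq f g : f \in B -> g \in B -> f ** f = f -> g ** g = g ->
  nil (f - g) -> f = g.
Proof.
move=> fB gB ff gg fgn; set d := f - g.
have dB : d \in B by rewrite memvB.
have ddE : d ** d = f + g - (f ** g + f ** g).
  by rewrite /d (bBl bil) // !(bBr bil) // ff gg (mC gB) // opprB addrACA opprD.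
have d3 : d = d ** (d ** d).
  have fd : f ** (d ** d) = f - f ** g.
    rewrite ddE (bBr bil) // !(bDr bil) // ff mA // ff; rewrite opprD addrA addrK //.
  have gd : g ** (d ** d) = g - f ** g.
    rewrite ddE (bBr bil) // !(bDr bil) // gg (mC gB) // [_ ** (f ** g)]mC // -mA // gg.
    by rewrite [f ** g + g]addrC opprD addrA addrK.
  by rewrite {2}/d (bBl bil) // fd gd opprB addrA addrNK.
apply/eqP; rewrite -subr_eq0 -/d; apply/eqP.
by apply: (fixed_by_nilp dB _ d3) => //; apply/nilp_sq.
Qed.

Lemma unit_of_surj c : c \in B -> (lmul m c @: B)%VS = B ->
  exists f, [/\ f \in B, c ** f = c & forall w, w \in B -> f ** w = w].
Proof.
move=> cB cimg; have := cB; rewrite -{1}cimg => /memv_imgP[f fB].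
rewrite (lmulE bil) // => cf; exists f; split=> // w; rewrite -{1}cimg.
by case/memv_imgP => w' w'B; rewrite (lmulE bil) // => ->; rewrite mA // (mC fB) // -cf.
Qed.

End CommutativeAlgebra.

Lemma calg_sub (K : fieldType) (V : vectType K) (m : V -> V -> V)
    (B C : {vspace V}) :
  (C <= B)%VS -> (forall x y, x \in C -> y \in C -> m x y \in C) ->
  calg m B -> calg m C.
Proof.
move=> /subvP CB Ccl [bil _ mC mA].
by split=> // [x y /CB xB /CB|x y z /CB xB /CB yB /CB]; [apply: mC | apply: mA].
Qed.

Ltac memB := first [ assumption | lazymatch goal with
  | |- is_true (in_mem (_ + _) _) => apply: memvD; memB
  | |- is_true (in_mem (- _) _) => rewrite memvN; memB
  | |- is_true (in_mem (_ *: _) _) => apply: memvZ; memB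
  | |- is_true (in_mem 0 _) => exact: mem0v
  | |- _ => eapply calg_closed; [eassumption | memB | memB]
  end ].

(* The stable image C of multiplication by x is an ideal on which a power of x
   is invertible, and the inverse image of that power is the unit of C. *)
Lemma nonnilp_idem (K : fieldType) (V : vectType K) (m : V -> V -> V)
    (B : {vspace V}) x :
  calg m B -> x \in B -> ~ nilp m x ->
  exists f g, [/\ f \in B, f != 0, m f f = f, g \in B & m x g = f].
Proof.
move=> mB xB xn; have bil := calg_bil mB.
pose F U := (lmul m x @: U)%VS.
pose C j := iter j F B.
have CP j : (C j <= B)%VS /\ forall b c, b \in B -> c \in C j -> m b c \in C j.
  elim: j => [|j [/subvP CB Cid]]; first by split=> // b c bB cB; memB.
  split.
    by apply/subvP => _ /memv_imgP[c /CB cB ->]; rewrite (lmulE bil) //; memB.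
  move=> b _ bB /memv_imgP[c cC ->]; have cB := CB _ cC.
  rewrite (lmulE bil) (mCA mB) //.
  by rewrite -(lmulE bil); apply/memv_img/Cid.
have [k Ck] : exists k, C k.+1 = C k.
  apply: stable_iter => j; apply/subvP => _ /memv_imgP[c cC ->].
  by rewrite (lmulE bil) //; apply: (CP j).2.
(* Multiplication by x^(2^j) factors through multiplication by [x]. This puts x^(2^j) into the j-th
   image, so the stable image contains a power of [x]. *)
have cF j U : (U <= B)%VS -> (forall b c, b \in B -> c \in U -> m b c \in U) ->
    forall u, u \in U -> m (iter j (sq m) x) u \in F U.
  move=> /subvP UB Uid; elim: j => [|j IHj] u uU.
    by rewrite -(lmulE bil) memv_img.
  have cjB := iter_sq_cl mB j xB.
  have uB := UB _ uU; rewrite iterS {1}/sq -(mA mB) //.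
  by apply: IHj; apply: Uid.
have cC j : iter j (sq m) x \in C j.
  by elim: j => // j IHj; apply: cF => //; [exact: (CP j).1 | exact: (CP j).2].
have {CP} [/subvP CB Cid] := CP k.
have cimg j : (lmul m (iter j (sq m) x) @: C k)%VS = C k.
  elim: j => [|j IHj]; first by [].
  rewrite -{2}IHj -{2}IHj -limg_comp; apply: eq_in_limg => u /CB uB.
  have cjB := iter_sq_cl mB j xB.
  by rewrite comp_lfunE !(lmulE bil) (mA mB).
set c := iter k (sq m) x in cimg *.
have c0 : c != 0 by apply/eqP => c0; apply: xn; exists k.
have mBC : calg m (C k) by apply: calg_sub mB; [apply/subvP | move=> ? ? /CB; apply: Cid].
have [f [fC cf fP]] := unit_of_surj mBC (cC k) (cimg k).
have /memv_imgP[g gC fE] : f \in F (C k) by rewrite -[F _]/(C k.+1) Ck.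
exists f, g; split; [exact: CB | | exact: fP | exact: CB | by rewrite fE (lmulE bil)].
by apply: contraNneq c0 => f0; rewrite -[c]cf f0 (b0r bil).
Qed.

(** * Wedderburn decomposition over the reals: the local case *)

Section Wedderburn.
Variables (R : realType) (V : vectType R) (m : V -> V -> V).

Definition wspan n (e y : 'I_n -> V) : {vspace V} :=
  (\sum_(i < n) (<[e i]> + <[y i]>))%VS.

(* A commutative algebra is, up to nilpotents, a sum of copies of the reals
   (e i with y i = 0) and of the complex numbers (with unit e i and imaginary
   unit y i). *)
Record wedderburn (B : {vspace V}) n (e y : 'I_n -> V) : Prop := Wedderburn {
  wedd_eB : forall i, e i \in B;
  wedd_yB : forall i, y i \in B;
  wedd_e0 : forall i, e i != 0;
  wedd_ee : forall i j, m (e i) (e j) = if i == j then e i else 0;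
  wedd_ey : forall i, m (e i) (y i) = y i;
  wedd_yy : forall i, y i = 0 \/ m (y i) (y i) = - e i;
  wedd_span : forall x, x \in B -> exists2 s, s \in wspan e y & nilp m (x - s)
}.

Lemma wspan1 (e y : V) : wspan (fun=> e) (fun=> y : V) (n := 1) = (<[e]> + <[y]>)%VS.
Proof. by rewrite /wspan big_ord1. Qed.

(** The residue field is R or C. Every [z] satisfies a real quadratic equation modulo nilpotents. If
    all residues are real, the line of [f] suffices; otherwise a square root [y] of [- f] exists and
    splits each quadratic into two linear factors, one of which is nilpotent. *)
Lemma wedderburn_unit (B : {vspace V}) f : calg m B -> f \in B -> f != 0 ->
  (forall x, x \in B -> m f x = x) ->
  (forall x, x \in B -> ~ nilp m x -> exists2 g, g \in B & m x g = f) ->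
  exists n (e y : 'I_n -> V), wedderburn B e y.
Proof.
move=> mB fB f0 fx inv; have bil := calg_bil mB.
have xf x : x \in B -> m x f = x by move=> xB; rewrite (mC mB) ?fx.
have fn : ~ nilp m f by move/nilp_idem => f00; case/eqP: f0; apply: f00; apply: fx.
(* The quadratic expression annihilates the nonzero vector supplied by [lfun_quadratic_factor], so
   it is not invertible and must be nilpotent. *)
have quad z : z \in B -> exists a b,
    nilp m (m (z - a *: f) (z - a *: f) + (b ^+ 2) *: f).
  move=> zB.
  have B0 : B != 0%VS by apply: contraNneq f0 => B0; rewrite -memv0 -B0.
  have zBB : (lmul m z @: B <= B)%VS.
    by apply/subvP => _ /memv_imgP[u uB ->]; rewrite (lmulE bil) //; memB.
  have [a [b [v [vB v0]]]] := lfun_quadratic_factor B0 zBB.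
  rewrite !(lmulE bil) // => zv; exists a, b.
  set w := (X in nilp m X).
  have wB : w \in B by rewrite /w -scaleNr; memB.
  apply: contrapT => /(inv _ wB)[g gB wg].
  case/eqP: v0; rewrite -(fx v vB) -wg (mC mB wB) // -(mA mB) //.
  suff -> : m w v = 0 by rewrite (b0r bil).
  have zf u : u \in B -> m (z - a *: f) u = m z u - a *: u.
    by move=> uB; rewrite (bBl bil) // (bZl bil) // fx.
  have zfB : z - a *: f \in B by rewrite -scaleNr; memB.
  rewrite /w (bDl bil (m _ _)) // (bZl bil) // fx // -(mA mB) // !zf //;
    last by rewrite -scaleNr; memB.
  rewrite -[RHS]zv (bBr bil) // (bZr bil) // scalerBr scalerA opprB.
  rewrite !scalerDl -!expr2 opprD !addrA.
  by congr (_ + _); rewrite addrAC.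
have nonunit p : p \in B -> nilp m p \/ exists2 g, g \in B & m p g = f.
  by move=> pB; have [] := pselect (nilp m p); [left | move/(inv p pB); right].
have nilM p q : p \in B -> q \in B -> nilp m (m p q) -> nilp m p \/ nilp m q.
  move=> pB qB pq; have [|[g gB pg]] := nonunit p pB; first by left.
  right; rewrite -(fx q qB) -pg (mC mB pB) // -(mA mB) //.
  by apply: (nilpMr mB) => //; memB.
(* Newton's iteration for the square root of - f. *)
have newton j w : w \in B -> iter j (sq m) (m w w + f) = 0 ->
    exists2 y, y \in B & m y y = - f.
  elim: j w => [|j IHj] w wB /=.
    by move/eqP; rewrite addr_eq0 => /eqP ww; exists w.
  rewrite -iterS iterSr; set t := m w w + f => tj.
  have tB : t \in B by rewrite /t; memB.
  have [wn|[g gB wg]] := nonunit w wB.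
    case: fn; have -> : f = t - m w w by rewrite /t addrC addKr.
    apply: (nilpB mB) => //; [memB | by exists j.+1; rewrite iterSr | exact/(nilp_sq mB)].
  (* [h] stands for t / (2 w): then (w - h)^2 + f = h^2 is a multiple of t^2, so the new error is
     killed by one squaring fewer. *)
  pose h := 2^-1 *: m t g : V.
  have hB : h \in B by rewrite /h; memB.
  have wh : m w h = 2^-1 *: t.
    by rewrite /h (bZr bil) // (mCA mB) // wg xf.
  apply: (IHj (w - h)); first by rewrite memvB.
  have -> : m (w - h) (w - h) + f = m (sq m t) (m (2^-1 *: g) (2^-1 *: g)).
    rewrite /sq (mACA mB) //; [|memB|memB].
    rewrite (bZr bil) -/h (bBl bil) !(bBr bil) (mC mB hB wB) wh.
    have -> : m w w = t - f by rewrite addrK.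
    have tE : t = 2^-1 *: t + 2^-1 *: t.
      rewrite -scalerDl (_ : _ + _ = 1) ?scale1r //; by field.
    rewrite {1}tE; move: (2^-1 *: t) (m h h) => u hh.
    by rewrite opprB [u + u - f - u]addrAC addrK addrAC subrK addrC subrK.
  by rewrite (iter_sqM mB) ?tj ?(b0l bil) // /sq; memB.
pose re z := exists a, nilp m (z - a *: f).
have fBa z a : z \in B -> z - a *: f \in B by move=> zB; rewrite -scaleNr; memB.
have [allre|] := pselect (forall z, z \in B -> re z).
  exists 1, (fun=> f), (fun=> 0); split=> //.
  - by move=> _; apply: mem0v.
  - by move=> i j; rewrite (ord1 i) (ord1 j) eqxx fx.
  - by move=> i; rewrite (b0r bil).
  - by move=> _; left.
  move=> x /allre[a xa]; exists (a *: f) => //.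
  by rewrite wspan1; apply/(subvP (addvSl _ _)); rewrite memvZ // memv_line.
move/existsNP => [z /not_implyP[zB znre]].
have [y yB yy] : exists2 y, y \in B & m y y = - f.
  have [a [b zab]] := quad z zB.
  have b0 : b != 0.
    apply/eqP => b0; apply: znre; exists a; apply/(nilp_sq mB).
    by move: zab; rewrite b0 expr0n /= scale0r addr0.
  pose w := b^-1 *: (z - a *: f).
  have [j wj] : nilp m (m w w + f).
    have := nilpZ mB (b ^- 2) zab.
    rewrite scalerDr scalerA mulVf ?expf_neq0 // scale1r.
    by rewrite /w (bZl bil) // (bZr bil) // scalerA -expr2 exprVn.
  by apply: (newton j w) => //; apply: memvZ; apply: fBa.
exists 1, (fun=> f), (fun=> y); split=> //.
- by move=> i j; rewrite (ord1 i) (ord1 j) eqxx fx.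
- by move=> i; apply: fx.
- by move=> _; right.
move=> x xB; have [a [b]] := quad x xB; set t := x - a *: f.
have tB : t \in B by apply: fBa.
have sqD u : u \in B -> m u u + b ^+ 2 *: f = m (u - b *: y) (u + b *: y).
  move=> uB; have byB : b *: y \in B by memB.
  rewrite (bBl bil u) !(bDr bil) (mC mB byB uB) opprD addrA addrK.
  by rewrite (bZl bil) (bZr bil) yy scalerA -expr2 scalerN opprK.
rewrite (sqD t tB).
have sB c : t + c *: y \in B by memB.
have mem c : a *: f + c *: y \in wspan (fun=> f) (fun=> y) (n := 1).
  by rewrite wspan1; apply: memv_add; apply: memvZ; apply: memv_line.
have sB' : t - b *: y \in B by rewrite -scaleNr.
case/(nilM _ _ sB' (sB b)) => tn; first by exists (a *: f + b *: y); rewrite ?opprD ?addrA.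
by exists (a *: f + (- b) *: y); rewrite // opprD addrA scaleNr opprK.
Qed.

End Wedderburn.

(** * Wedderburn decomposition: reduction to the local case *)

Section WedderburnExistence.
Variables (R : realType) (V : vectType R) (m : V -> V -> V).

Lemma mem_wspan_e n (e y : 'I_n -> V) i : e i \in wspan e y.
Proof.
apply/(subvP (sumv_sup i _ (subvv _))) => //; apply/(subvP (addvSl _ _)).
exact: memv_line.
Qed.

Lemma mem_wspan_y n (e y : 'I_n -> V) i : y i \in wspan e y.
Proof.
apply/(subvP (sumv_sup i _ (subvv _))) => //; apply/(subvP (addvSr _ _)).
exact: memv_line.
Qed.

Lemma wspan_sub n (e y : 'I_n -> V) (U : {vspace V}) :
  (forall i, e i \in U) -> (forall i, y i \in U) -> (wspan e y <= U)%VS.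
Proof.
by move=> eU yU; apply/subv_sumP => i _; rewrite subv_add -!memvE eU yU.
Qed.

Definition fjoin n1 n2 (e1 : 'I_n1 -> V) (e2 : 'I_n2 -> V) (i : 'I_(n1 + n2)) :=
  match split i with inl j => e1 j | inr j => e2 j end.

Lemma fjoinl n1 n2 (e1 : 'I_n1 -> V) (e2 : 'I_n2 -> V) i :
  fjoin e1 e2 (lshift n2 i) = e1 i.
Proof. by rewrite /fjoin -[lshift _ _]/(unsplit (inl i)) unsplitK. Qed.

Lemma fjoinr n1 n2 (e1 : 'I_n1 -> V) (e2 : 'I_n2 -> V) i :
  fjoin e1 e2 (rshift n1 i) = e2 i.
Proof. by rewrite /fjoin -[rshift _ _]/(unsplit (inr i)) unsplitK. Qed.

Lemma wspan_join n1 n2 (e1 y1 : 'I_n1 -> V) (e2 y2 : 'I_n2 -> V) :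
  wspan (fjoin e1 e2) (fjoin y1 y2) = (wspan e1 y1 + wspan e2 y2)%VS.
Proof.
rewrite /wspan big_split_ord; congr (_ + _)%VS; apply: eq_bigr => i _.
  by rewrite !fjoinl.
by rewrite !fjoinr.
Qed.

Lemma wedderburn_join (B B1 B2 : {vspace V}) n1 n2
    (e1 y1 : 'I_n1 -> V) (e2 y2 : 'I_n2 -> V) :
  calg m B -> (B1 <= B)%VS -> (B2 <= B)%VS ->
  (forall x1 x2, x1 \in B1 -> x2 \in B2 -> m x1 x2 = 0) ->
  (forall x, x \in B -> exists x1 x2, [/\ x1 \in B1, x2 \in B2 & x = x1 + x2]) ->
  wedderburn m B1 e1 y1 -> wedderburn m B2 e2 y2 ->
  wedderburn m B (fjoin e1 e2) (fjoin y1 y2).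
Proof.
move=> mB /subvP B1B /subvP B2B m12 dec w1 w2.
split=> [i|i|i|i j|i|i|x].
- by case: (split_ordP i) => k ->; rewrite ?fjoinl ?fjoinr;
     [apply/B1B/(wedd_eB w1) | apply/B2B/(wedd_eB w2)].
- by case: (split_ordP i) => k ->; rewrite ?fjoinl ?fjoinr;
     [apply/B1B/(wedd_yB w1) | apply/B2B/(wedd_yB w2)].
- by case: (split_ordP i) => k ->; rewrite ?fjoinl ?fjoinr;
     [apply: (wedd_e0 w1) | apply: (wedd_e0 w2)].
- have e1B k := wedd_eB w1 k; have e2B k := wedd_eB w2 k.
  case: (split_ordP i) => k ->; case: (split_ordP j) => l ->.
  + by rewrite !fjoinl (wedd_ee w1) eq_lshift.
  + by rewrite fjoinl fjoinr m12 // eq_lrshift.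
  + by rewrite fjoinl fjoinr (mC mB) ?m12 ?eq_rlshift //; [apply: B2B | apply: B1B].
  + by rewrite !fjoinr (wedd_ee w2) eq_rshift.
- by case: (split_ordP i) => k ->; rewrite ?fjoinl ?fjoinr;
     [apply: (wedd_ey w1) | apply: (wedd_ey w2)].
- by case: (split_ordP i) => k ->; rewrite ?fjoinl ?fjoinr;
     [apply: (wedd_yy w1) | apply: (wedd_yy w2)].
case/dec => x1 [x2 [x1B x2B ->]].
have [s1 s1S n1x] := wedd_span w1 x1B; have [s2 s2S n2x] := wedd_span w2 x2B.
exists (s1 + s2); first by rewrite wspan_join; apply: memv_add.
have s1B : s1 \in B.
  apply: (subvP _ _ s1S); apply: wspan_sub => i; apply: B1B;
  [exact: (wedd_eB w1) | exact: (wedd_yB w1)].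
have s2B : s2 \in B.
  apply: (subvP _ _ s2S); apply: wspan_sub => i; apply: B2B;
  [exact: (wedd_eB w2) | exact: (wedd_yB w2)].
have := B1B _ x1B; have := B2B _ x2B => x2BB x1BB.
by rewrite opprD addrACA; apply: (nilpD mB) => //; rewrite memvB.
Qed.

(** Induction on the dimension. A nonzero idempotent [f] with f B different from [B] gives the
    Peirce splitting into f B and the annihilator of [f], both smaller. If there is none, every
    nonzero idempotent is the unit; a non-nilpotent element divides such an idempotent, so it is
    invertible and the local case applies. *)
Theorem wedderburn_exists (B : {vspace V}) :
  calg m B -> exists n (e y : 'I_n -> V), wedderburn m B e y.
Proof.
have [k leBk] := ubnP (\dim B); elim: k B leBk => // k IHk B.
rewrite ltnS => leBk mB; have bil := calg_bil mB.
have [alln|] := pselect (forall x, x \in B -> nilp m x).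
  exists 0, (fun=> 0), (fun=> 0); split=> [[]|[]|[]|[]|[]|[]|x xB] //.
  by exists 0; [exact: mem0v | rewrite subr0; apply: alln].
move=> /existsNP[x0 /not_implyP[x0B x0n]].
have [[f [fB f0 ff fimg]]|full] := pselect (exists f,
    [/\ f \in B, f != 0, m f f = f & (lmul m f @: B)%VS <> B]).
  pose B1 := (lmul m f @: B)%VS; pose B2 := (B :&: lker (lmul m f))%VS.
  have B1P x : x \in B1 -> x \in B /\ m f x = x.
    case/memv_imgP => u uB ->; rewrite (lmulE bil) //; split; first by memB.
    by rewrite (mA mB) // ff.
  have B2P x : (x \in B2) = (x \in B) && (m f x == 0).
    by rewrite memv_cap memv_ker (lmulE bil).
  have B1B : (B1 <= B)%VS by apply/subvP => x /B1P[].
  have B2B : (B2 <= B)%VS by apply: capvSl.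
  have dB1 : (\dim B1 < \dim B)%N.
    rewrite ltn_neqAle (dimvS B1B) andbT (dimv_leqif_eq B1B).
    by apply/eqP.
  have dB2 : (\dim B2 < \dim B)%N.
    rewrite ltn_neqAle (dimvS B2B) andbT (dimv_leqif_eq B2B).
    by apply: contra_neqN f0 => /eqP B2E; move: fB; rewrite -B2E B2P ff => /andP[_ /eqP].
  have mB1 : calg m B1.
    apply: calg_sub (mB) => // x y /B1P[xB fx] /B1P[yB fy].
    by rewrite -fx -(mA mB) // -(lmulE bil); apply: memv_img; memB.
  have mB2 : calg m B2.
    apply: calg_sub (mB) => // x y; rewrite !B2P => /andP[xB /eqP fx] /andP[yB /eqP fy].
    by rewrite (mA mB) // fx (b0l bil) // eqxx andbT; memB.
  have [n1 [e1 [y1 w1]]] := IHk _ (leq_trans dB1 leBk) mB1.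
  have [n2 [e2 [y2 w2]]] := IHk _ (leq_trans dB2 leBk) mB2.
  exists (n1 + n2)%N, (fjoin e1 e2), (fjoin y1 y2).
  apply: (wedderburn_join mB _ _ _ _ w1 w2) => // [x1 x2 /B1P[x1B <-]|x xB].
    by rewrite B2P => /andP[x2B /eqP fx2]; rewrite (mC mB fB) // -(mA mB) // fx2 (b0r bil).
  exists (m f x), (x - m f x); split; last by rewrite addrC addrNK.
    by rewrite -(lmulE bil); apply: memv_img.
  by rewrite B2P (bBr bil) // (mA mB) // ff subrr eqxx andbT memvB //; memB.
have unitP f : f \in B -> f != 0 -> m f f = f -> forall x, x \in B -> m f x = x.
  move=> fB f0 ff x xB; have fimg : (lmul m f @: B)%VS = B.
    by apply: contrapT => fimg; apply: full; exists f.
  move: xB; rewrite -{1}fimg => /memv_imgP[u uB ->].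
  by rewrite (lmulE bil) // (mA mB) // ff.
have [f [_ [fB f0 ff _ _]]] := nonnilp_idem mB x0B x0n.
apply: (wedderburn_unit mB fB f0 (unitP f fB f0 ff)) => x xB xn.
have [f' [g [f'B f'0 ff' gB xg]]] := nonnilp_idem mB xB xn.
exists g => //; rewrite xg -(unitP f' f'B f'0 ff' f fB) (mC mB) //.
by rewrite unitP.
Qed.

End WedderburnExistence.

(** * The semisimple part and its rigidity modulo nilpotents *)

Section WedderburnTheory.
Variables (R : realType) (V : vectType R) (m : V -> V -> V).
Variables (B : {vspace V}) (n : nat) (e y : 'I_n -> V).
Hypotheses (mB : calg m B) (wB : wedderburn m B e y).

Let bil := calg_bil mB.
Let S := wspan e y.
Let u := \sum_i e i.
Let eB := wedd_eB wB.
Let yB := wedd_yB wB.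
Let ee := wedd_ee wB.
Let ey := wedd_ey wB.
Let yy := wedd_yy wB.

Lemma wspan_subB : (S <= B)%VS. Proof. exact: wspan_sub. Qed.

Let SB x : x \in S -> x \in B. Proof. exact/subvP/wspan_subB. Qed.

Lemma wspanP s : s \in S ->
  exists a b : 'I_n -> R, s = \sum_i (a i *: e i + b i *: y i).
Proof.
case/memv_sumP => t tS ->.
have ex i : exists ab : R * R, t i = ab.1 *: e i + ab.2 *: y i.
  have /memv_addP[_ /vlineP[a ->] [_ /vlineP[b ->] ->]] := tS i isT.
  by exists (a, b).
have [ab abE] := choice ex; exists (fun i => (ab i).1), (fun i => (ab i).2).
exact: eq_bigr.
Qed.

Lemma wedd_eyn i j : m (e i) (y j) = if i == j then y i else 0.
Proof.
rewrite -(ey j) (mA mB) // ee; case: eqP => [->|_]; first exact: ey.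
by rewrite (b0l bil).
Qed.

Lemma wedd_yyn i j : m (y i) (y j) = if i == j then m (y i) (y i) else 0.
Proof.
case: eqP => [->//|/eqP ij]; rewrite -(ey i) (mC mB (eB i)) // -(mA mB) // wedd_eyn.
by rewrite (negPf ij) (b0r bil).
Qed.

Lemma wspan_comp i s : s \in S ->
  exists a b, m (e i) s = a *: e i + b *: y i.
Proof.
case/wspanP => a [b ->]; exists (a i), (b i).
rewrite (bsumr bil) // (bigD1 i) //= big1 => [|j ji].
  by rewrite addr0 (bDr bil) // !(bZr bil) // ee ey eqxx.
by rewrite (bDr bil) // !(bZr bil) // ee wedd_eyn eq_sym (negPf ji) !scaler0 addr0.
Qed.

Lemma wedd_unitB : u \in S.
Proof. by apply: memv_suml => i _; apply: mem_wspan_e. Qed.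

Lemma wspan_unit s : s \in S -> m u s = s.
Proof.
move: s; suff /subvP H : (S <= lker (lmul m u - \1%VF))%VS.
  by move=> s /H; rewrite memv_ker add_lfunE opp_lfunE id_lfunE (lmulE bil) subr_eq0 => /eqP.
have uP i s : m (e i) s = s -> (forall j, j != i -> m (e j) s = 0) -> m u s = s.
  by move=> eis ejs; rewrite /u (bsuml bil) // (bigD1 i) //= eis big1 ?addr0.
apply: wspan_sub => i; rewrite memv_ker add_lfunE opp_lfunE id_lfunE (lmulE bil) subr_eq0.
  by rewrite (uP i) // => [|j ji]; rewrite ee ?eqxx // (negPf ji).
by rewrite (uP i) // => j ji; rewrite wedd_eyn (negPf ji).
Qed.

Lemma wspan_decomp s : s \in S -> s = \sum_i m (e i) s.
Proof. by move=> sS; rewrite -{1}(wspan_unit sS) (bsuml bil). Qed.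

Lemma wspan_closed s t : s \in S -> t \in S -> m s t \in S.
Proof.
case/wspanP => a [b ->] /wspanP[c [d ->]].
rewrite (bsuml bil) //; apply: memv_suml => i _; rewrite (bsumr bil) //.
have eS j : e j \in S by apply: mem_wspan_e.
have yS j : y j \in S by apply: mem_wspan_y.
apply: memv_suml => j _; rewrite (bDl bil) // !(bDr bil) // !(bZl bil) // !(bZr bil) //.
rewrite (mC mB (yB i) (eB j)) ee !wedd_eyn wedd_yyn.
by rewrite !memvD // !memvZ //; case: eqP => // _; rewrite ?mem0v //;
  case: (yy i) => [->|->]; rewrite ?(b0l bil) ?mem0v ?memvN.
Qed.

Lemma calg_wspan : calg m S.
Proof. by apply: calg_sub mB; [exact: wspan_subB | exact: wspan_closed]. Qed.

(** In some component [s] is a nonzero element of a copy of R or C, hence invertible there; [f] is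
    the unit of that copy. *)
Lemma wspan_inv s : s \in S -> s != 0 ->
  exists t f, [/\ t \in S, f \in S, f != 0, m f f = f & m s t = f].
Proof.
move=> sS s0; have [i es0] : exists i, m (e i) s != 0.
  apply: contrapT => /forallNP es; case/eqP: s0; rewrite (wspan_decomp sS) big1 // => i _.
  exact/eqP/negPn/negP/es.
have [a [b esE]] := wspan_comp i sS.
have eS : e i \in S by apply: mem_wspan_e.
have yS : y i \in S by apply: mem_wspan_y.
have SS := wspan_closed.
suff [t tS tE] : exists2 t, t \in S & m (m (e i) s) t = e i.
  exists (m (e i) t), (e i); rewrite (wedd_e0 wB) ee eqxx; split=> //.
    exact: wspan_closed.
  by have sB := SB sS; have tB := SB tS; rewrite (mA mB) // (mC mB sB).
case: (yy i) => [y0|y2].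
  move: es0; rewrite esE y0 scaler0 addr0 => ae0.
  have a0 : a != 0 by apply: contraNneq ae0 => ->; rewrite scale0r.
  exists (a^-1 *: e i); first exact: memvZ.
  by rewrite (bZl bil) // (bZr bil) // ee eqxx scalerA divff // scale1r.
have ab0 : a ^+ 2 + b ^+ 2 != 0.
  apply: contraNneq es0 => /eqP; rewrite paddr_eq0 ?sqr_ge0 // !sqrf_eq0.
  by rewrite esE => /andP[/eqP-> /eqP->]; rewrite !scale0r addr0.
(* The conjugate divided by the norm, with [y i] as imaginary unit. *)
exists ((a ^+ 2 + b ^+ 2)^-1 *: (a *: e i - b *: y i)).
  by apply: memvZ; rewrite memvB // memvZ.
have ye : m (y i) (e i) = y i by rewrite (mC mB).
have ei : m (e i) (e i) = e i by rewrite ee eqxx.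
rewrite esE (bZr bil) (bDl bil) !(bBr bil) !(bZl bil) !(bZr bil) ye ei ey y2.
rewrite !scalerN opprK !scalerA -!expr2 [b * a]mulrC addrA subrK.
by rewrite -scalerDl scalerA mulVf // scale1r.
Qed.

Lemma wspan_reduced s : s \in S -> nilp m s -> s = 0.
Proof.
move=> sS sn; apply/eqP/negPn/negP => /(wspan_inv sS)[t [f [tS fS f0 ff st]]].
case/eqP: f0; apply: (nilp_idem ff); rewrite -st.
by apply: (nilpMl mB) => //; apply: SB.
Qed.

(** Writing f = s + k with [k] nilpotent gives u - f = u k - k, so these two idempotents differ by a
    nilpotent. *)
Lemma wedd_unitE f : f \in B -> (forall x, x \in B -> m f x = x) -> u = f.
Proof.
move=> fB fx; have uB : u \in B by apply: SB wedd_unitB.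
have uu : m u u = u by apply/wspan_unit/wedd_unitB.
have ff : m f f = f by apply: fx.
apply: (idem_eq mB) => //; have [s sS] := wedd_span wB fB.
set k := f - s => kn; have sB := SB sS.
have kB : k \in B by rewrite memvB.
have fE : f = s + k by rewrite addrC subrK.
have -> : u - f = m u k - k.
  rewrite -{1}(fx u uB) (mC mB) // {1}fE (bDr bil) wspan_unit //.
  by rewrite fE opprD addrACA subrr add0r.
by apply: (nilpB mB) => //; [memB | apply: (nilpMr mB)].
Qed.

(* A root of a separable equation is determined modulo nilpotents. *)
Lemma wedd_sqrt_uniq i y' : y' \in B -> m (e i) y' = y' ->
  (y i = 0 -> y' = 0) -> (m (y i) (y i) = - e i -> m y' y' = - e i) ->
  nilp m (y' - y i) -> y' = y i.
Proof.
move=> y'B ey' y'0 y'2; case: (yy i) => [y0|y2]; first by rewrite y'0 // y0.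
have [k kE] : exists k, k = y' - y i by exists (y' - y i).
have {}y'2 := y'2 y2; rewrite -kE => kn; have yiB := yB i; have eiB := eB i.
have kB : k \in B by rewrite kE memvB.
have ek : m (e i) k = k by rewrite kE (bBr bil) ey' ey.
have y'E : y' = y i + k by rewrite kE addrC subrK.
have : m (y i + k) (y i + k) = - e i by rewrite -y'E.
rewrite (bDl bil) !(bDr bil) y2 (mC mB kB yiB) -addrA => /(canRL (addKr _)).
rewrite opprK subrr => yk.
(* Expanding (y + k)^2 = - e gives k^2 = - 2 y k. Multiplying by [y i] turns this into 2 k = k (y
   k), so [k] is fixed by a nilpotent. *)
have k2 : k + k = m k (m (y i) k).
  have -> : m k (m (y i) k) = m (y i) (m k k) by rewrite (mCA mB).
  have -> : m k k = - (m (y i) k + m (y i) k).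
    by apply/eqP; rewrite -addr_eq0 addrC -addrA yk.
  by rewrite (bNr bil) (bDr bil) (mA mB) // y2 !(bNl bil) ek opprD !opprK.
apply/eqP; rewrite -subr_eq0 -kE; apply/eqP.
apply: (fixed_by_nilp mB kB (_ : 2^-1 *: m (y i) k \in B)); first by memB.
  by rewrite (bZr bil) -k2 -mulr2n -scaler_nat scalerA mulVf ?scale1r // pnatr_eq0.
by apply: (nilpZ mB); apply: (nilpMr mB).
Qed.

End WedderburnTheory.

(** Let u be the sum of the [ew i] and x = s + k with [k] nilpotent. Then u x = 0 gives s = - u k,
    so x = k - u k. *)
Lemma wedd_nil (R : realType) (V : vectType R) m (B : {vspace V})
    n (ew yw : 'I_n -> V) x :
  calg m B -> wedderburn m B ew yw -> x \in B -> m (\sum_i ew i) x = 0 -> nilp m x.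
Proof.
move=> mB wB xB ux; have bil := calg_bil mB.
have [s sS ns] := wedd_span wB xB; have sB := subvP (wspan_subB wB) _ sS.
have uB : \sum_i ew i \in B by apply: memv_suml => i _; apply: (wedd_eB wB).
have xsB : x - s \in B by rewrite memvB.
have -> : x = (x - s) - m (\sum_i ew i) (x - s).
  by rewrite (bBr bil) ux (wspan_unit mB wB sS) sub0r opprK subrK.
by apply: (nilpB mB) => //; [memB | apply: (nilpMr mB)].
Qed.

(** * 2-step solvable Lie algebras with complex structure *)

Definition Jmul (R : realType) (V : vectType R) (br : V -> V -> V) (J : 'End(V)) :=
  fun x y : V => br (J x) y.

Section LieBasics.
Variables (R : realType) (V : vectType R) (br : V -> V -> V) (J : 'End(V)).
Hypotheses (lieP : lie_bracket br) (cplxP : complex_structure br J).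

Local Notation D := (derived br).
Local Notation I := (derivedJ br J).

Lemma lie_bilin : bilin br.
Proof. by split; [exact: lie_linearl | exact: lie_linearr]. Qed.
Local Notation bil := lie_bilin.

Lemma lie_spanP (U W X : {vspace V}) :
  (lie_span br U W <= X)%VS <->
  (forall x y, x \in U -> y \in W -> br x y \in X).
Proof.
split=> [/span_subvP UWX x y xU yW|UWX].
  rewrite (coord_vbasis xU) (coord_vbasis yW) (bsuml bil).
  apply: memv_suml => i _; rewrite (bsumr bil); apply: memv_suml => j _.
  rewrite (bZl bil) (bZr bil); do 2!apply: memvZ.
  by apply: UWX; apply: allpairs_f; rewrite mem_nth ?size_tuple.
apply/span_subvP => _ /allpairsP[[x y] /= [/vbasis_mem xU /vbasis_mem yW ->]].
exact: UWX.
Qed.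

Lemma mem_lie_span (U W : {vspace V}) x y :
  x \in U -> y \in W -> br x y \in lie_span br U W.
Proof. by move: x y; apply/lie_spanP. Qed.

Lemma br_derived x y : br x y \in D.
Proof. by apply: mem_lie_span; apply: memvf. Qed.

Lemma br_anti x y : br x y = - br y x.
Proof.
apply/eqP; rewrite -addr_eq0; apply/eqP.
have := lie_alt lieP (x + y); rewrite (bDl bil) !(bDr bil) !(lie_alt lieP).
by rewrite add0r addr0.
Qed.

Lemma br_jacobi x y z : br x (br y z) = br (br x y) z + br y (br x z).
Proof.
have /eqP := lie_jacobi lieP x y z.
rewrite -addrA addr_eq0 => /eqP->; rewrite opprD -(br_anti _ z) addrC; congr (_ + _).
by rewrite (br_anti z x) (bNr bil) opprK.
Qed.

Lemma JJ x : J (J x) = - x. Proof. exact: cplx_sqr cplxP x. Qed.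

Lemma mem_imgJ (U : {vspace V}) x : (x \in J @: U)%VS = (J x \in U).
Proof.
apply/idP/idP => [/memv_imgP[u uU ->]|JxU]; first by rewrite JJ memvN.
by rewrite -[x]opprK -JJ memv_img // linearN memvN.
Qed.

Lemma J_invP (U : {vspace V}) : J_invariant J U <-> (forall x, x \in U -> J x \in U).
Proof.
split=> [/subvP JU x xU|JU]; first by apply/JU/memv_img.
by apply/subvP => _ /memv_imgP[u uU ->]; apply: JU.
Qed.

Lemma mem_plusJP (U : {vspace V}) x :
  reflect (exists u v, [/\ u \in U, v \in U & x = u + J v]) (x \in U + J @: U)%VS.
Proof.
apply: (iffP memv_addP) => [[u uU [_ /memv_imgP[v vU ->] ->]]|[u [v [uU vU ->]]]].
  by exists u, v.
by exists u => //; exists (J v) => //; apply: memv_img.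
Qed.

Lemma mem_derivedJ x : (x \in I) = (x \in D) && (J x \in D).
Proof. by rewrite memv_cap mem_imgJ. Qed.

Lemma J_derivedJ x : x \in I -> J x \in I.
Proof. by rewrite !mem_derivedJ JJ memvN andbC. Qed.

Lemma subv_derivedJ x : x \in I -> x \in D.
Proof. by rewrite mem_derivedJ => /andP[]. Qed.

Lemma J_derivedP (U X : {vspace V}) : J_invariant J X ->
  (J_derived br J U <= X)%VS <-> (forall x y, x \in U -> y \in U -> br x y \in X).
Proof.
move=> /J_invP JX; rewrite subv_add; split=> [/andP[/lie_spanP ? _]//|UX].
have UX' : (lie_span br U U <= X)%VS by apply/lie_spanP.
by rewrite UX'; apply/subvP => x; rewrite mem_imgJ => /(subvP UX')/JX; rewrite JJ memvN.
Qed.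

Lemma J_derivedS (U W : {vspace V}) :
  (U <= W)%VS -> (J_derived br J U <= J_derived br J W)%VS.
Proof.
move=> /subvP UW; have UW' : (lie_span br U U <= lie_span br W W)%VS.
  by apply/lie_spanP => x y /UW xW /UW yW; apply: mem_lie_span.
by apply: addvS => //; apply: limgS.
Qed.

(** The series decreases and stabilises by finite dimension. Its limit equals its own J-derived
    space, so only such [W] have to be excluded. *)
Lemma J_solvableP (U : {vspace V}) : (J_derived br J U <= U)%VS ->
  (forall W, (W <= U)%VS -> J_derived br J W = W -> W = 0%VS) -> J_solvable br J U.
Proof.
move=> dU Wz.
have decr j : (iter j.+1 (J_derived br J) U <= iter j (J_derived br J) U)%VS.
  by elim: j => // j IHj; apply: J_derivedS.
have [j jE] := stable_iter decr; exists j; apply: Wz jE.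
by elim: j => // j; apply: subv_trans (decr j).
Qed.

Local Notation m := (Jmul br J).

(** If [t] and [J t] lie in one term of the series, then [m t t] and its image under [J] lie in the
    next: each squaring advances one step. *)
Lemma J_solvable_nilp (U : {vspace V}) t :
  J_solvable br J U -> t \in U -> J t \in U -> nilp m t.
Proof.
case=> j Uj tU JtU; exists j; apply/eqP; rewrite -memv0 -Uj.
suff [] : iter j (sq m) t \in iter j (J_derived br J) U /\
          J (iter j (sq m) t) \in iter j (J_derived br J) U by [].
elim: j {Uj} => //= j [IH1 IH2]; rewrite /sq.
have ttU := mem_lie_span IH2 IH1.
by split; [apply: (subvP (addvSl _ _)) | apply: (subvP (addvSr _ _)); apply: memv_img].
Qed.

Lemma m_bilin : bilin m.
Proof.
split=> [y a x z|x a y z]; rewrite /Jmul; first by rewrite linearP (bDl bil) (bZl bil).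
by rewrite (bDr bil) (bZr bil).
Qed.

Section TwoStep.
Hypothesis solvP : two_step_solvable br.

Lemma br_DD x y : x \in D -> y \in D -> br x y = 0.
Proof. by move=> xD yD; apply/eqP; rewrite -memv0 -solvP mem_lie_span. Qed.

Lemma br_comm x y z : z \in D -> br x (br y z) = br y (br x z).
Proof. by move=> zD; rewrite br_jacobi br_DD ?add0r // br_derived. Qed.

(** Integrability expresses [J] of this sum as [J z, J x] - [z, x], which is again in [D]. For [z]
    in [D] this is the commutativity of [m] modulo [I]. *)
Lemma br_J_derivedJ z x : x \in D -> br z (J x) + br (J z) x \in I.
Proof.
move=> xD; rewrite mem_derivedJ memvD ?br_derived //=.
have /eqP := cplx_integrable cplxP z x.
rewrite linearD /= subr_eq0 -addrA => /eqP/(canRL (addKr _)); rewrite addrC => ->.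
by rewrite addrC memvB ?br_derived.
Qed.

Lemma mD_derivedJ x y : x \in D -> y \in D -> m x y - m y x \in I.
Proof.
by move=> xD yD; have := br_J_derivedJ x yD; rewrite addrC (br_anti x) -/(m y x).
Qed.

Lemma m_derivedJl x y : x \in I -> y \in D -> m x y = 0.
Proof. by rewrite mem_derivedJ => /andP[_ JxD]; apply: br_DD. Qed.

Lemma m_derivedJr x y : x \in D -> y \in I -> m x y \in I.
Proof.
move=> xD yI; have := mD_derivedJ xD (subv_derivedJ yI).
by rewrite [X in _ - X]m_derivedJl // subr0.
Qed.

Lemma mD_CA x y z : z \in D -> m x (m y z) = m y (m x z).
Proof. exact: br_comm. Qed.

Lemma mDr x y : m x y \in D. Proof. exact: br_derived. Qed.

Lemma m_congl x x' y : x \in D -> x' \in D -> y \in D -> x - x' \in I -> m x y = m x' y.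
Proof.
move=> xD x'D yD /m_derivedJl/(_ yD); rewrite (bBl m_bilin) => /eqP.
by rewrite subr_eq0 => /eqP.
Qed.

(** Modulo [I], x (y z) = x (z y) = z (x y) = (x y) z; the middle equality is exact because [m x]
    and [m z] commute on [D]. *)
Lemma m_assoc_mod x y z : x \in D -> y \in D -> z \in D ->
  m x (m y z) - m (m x y) z \in I.
Proof.
move=> xD yD zD; have zy := mD_derivedJ zD yD.
have -> : m x (m y z) - m (m x y) z =
  (m z (m x y) - m (m x y) z) - m x (m z y - m y z).
  by rewrite (bBr m_bilin) opprB (mD_CA z) // [RHS]addrC addrA subrK.
by rewrite memvB // ?m_derivedJr // mD_derivedJ ?mDr.
Qed.

Lemma iter_sqD j x : x \in D -> iter j (sq m) x \in D.
Proof. by case: j => //= j _; apply: mDr. Qed.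

Lemma m_iter_sq j x y : x \in D -> y \in D ->
  iter (2 ^ j) (m x) y - m (iter j (sq m) x) y \in I.
Proof.
move=> xD; elim: j y => [|j IHj] y yD; first by rewrite /= subrr mem0v.
set s := iter j (sq m) x in IHj *.
have sD : s \in D by apply: iter_sqD.
have iD : iter (2 ^ j) (m x) y \in D by case: (2 ^ j)%N => [|k] //=; apply: mDr.
rewrite expnS mul2n -addnn iterD iterS -/s.
have h1 := IHj _ iD.
have h2 := m_derivedJr sD (IHj _ yD).
have h3 := m_assoc_mod sD sD yD.
have := memvD (memvD h1 h2) h3; rewrite (bBr m_bilin).
by rewrite !subrKA.
Qed.

Lemma nilp_mod_iter x : x \in D -> (exists j, iter j (sq m) x \in I) ->
  exists k, forall y, y \in D -> iter k (m x) y \in I.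
Proof.
move=> xD [j xj]; exists (2 ^ j)%N => z zD.
by have := m_iter_sq j xD zD; rewrite (m_derivedJl xj) // subr0.
Qed.

End TwoStep.
End LieBasics.

(** * The radical and its complement, given an adapted idempotent *)

Section Core.
Variables (R : realType) (V : vectType R) (br : V -> V -> V) (J : 'End(V)).
Hypotheses (lieP : lie_bracket br) (cplxP : complex_structure br J).
Hypothesis solvP : two_step_solvable br.

Local Notation D := (derived br).
Local Notation I := (derivedJ br J).
Local Notation m := (Jmul br J).
Local Notation nil := (nilp m).

Let brb := lie_bilin lieP.
Let mb := m_bilin J lieP.
Let JJ := JJ cplxP.
Let brD := br_derived lieP.
Let brC := br_comm lieP solvP.
Let ID := @subv_derivedJ _ _ br _ cplxP.

Variable e : V.
Hypotheses (eD : e \in D) (ee : m e e = e).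
Hypothesis eI : forall i, i \in I -> m e i = i -> i = 0.
(** The part of D / I annihilated by [e] is nil, so [e] represents the unit of the whole semisimple
    part and not just of a summand. *)
Hypothesis eN : forall x, x \in D -> m e x \in I -> exists j, iter j (sq m) x \in I.

Definition Gunit : {vspace V} := (D :&: lker (lmul m e - \1%VF))%VS.
Local Notation G := Gunit.

Lemma memG x : (x \in G) = (x \in D) && (m e x == x).
Proof.
by rewrite memv_cap memv_ker add_lfunE opp_lfunE id_lfunE (lmulE mb) subr_eq0.
Qed.

Lemma GD x : x \in G -> x \in D. Proof. by rewrite memG => /andP[]. Qed.

Lemma Ge x : x \in G -> m e x = x. Proof. by rewrite memG => /andP[_ /eqP]. Qed.

Lemma GI x : x \in G -> x \in I -> x = 0.
Proof. by rewrite memG => /andP[_ /eqP ex] xI; apply: eI. Qed.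

Lemma eG : e \in G. Proof. by rewrite memG eD ee eqxx. Qed.

Lemma br_G z x : x \in G -> br z x \in G.
Proof.
rewrite !memG brD => /andP[xD /eqP ex] /=; apply/eqP.
by rewrite [LHS]brC // -[br (J e) x]/(m e x) ex.
Qed.

Lemma brG_e z : br z e \in G. Proof. exact/br_G/eG. Qed.

Lemma GC x y : x \in G -> y \in G -> m x y = m y x.
Proof.
move=> xG yG; apply/eqP; rewrite -subr_eq0; apply/eqP/GI.
  by rewrite memvB //; apply: br_G.
by apply: mD_derivedJ => //; apply: GD.
Qed.

Lemma G_e x : x \in G -> m x e = x.
Proof. by move=> xG; rewrite (GC xG eG) Ge. Qed.

Lemma calgG : calg m G.
Proof.
split=> // [x y _|x y|x y z xG yG zG]; [exact: br_G | exact: GC |].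
by rewrite (GC yG zG) mD_CA ?(GD yG) // (GC zG) //; apply: br_G.
Qed.

Lemma br_Gx z x : x \in G -> br z x = m x (br z e).
Proof. by move=> xG; rewrite -{1}(G_e xG) [LHS]brC. Qed.

(** As [D] is abelian, integrability reduces the bracket to [J] of [m x y - m y x], and [m] is
    commutative on [G]. *)
Lemma br_JGJG x y : x \in G -> y \in G -> br (J x) (J y) = 0.
Proof.
move=> xG yG; have /eqP := cplx_integrable cplxP x y.
rewrite (br_DD lieP solvP (GD xG) (GD yG)) add0r subr_eq0 => /eqP<-.
rewrite (br_anti lieP x) -/(m y x) -/(m x y) (GC xG yG) linearN.
exact: subrr.
Qed.

(* On [D], [u |-> m u e] is the projection onto the eigenspace [G] of
   [m e] for the eigenvalue 1. *)

Lemma pe_fix u : u \in D -> m (m e u) e = m u e.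
Proof.
move=> uD; have ueD : m u e \in D := brD _ _.
have euD : m e u \in D := brD _ _.
rewrite (@m_congl _ _ _ _ lieP cplxP solvP (m e u) (m u e)) //.
  by apply: G_e; apply: brG_e.
exact: mD_derivedJ.
Qed.

(** [m e - 1] is injective on the finite-dimensional [I] by [eI], hence onto. The same surjectivity
    later corrects an approximate idempotent. *)
Lemma subI i : i \in I -> exists2 i', i' \in I & i = m e i' - i'.
Proof.
move=> iI; pose f : 'End(V) := lmul m e - \1%VF.
have fE x : f x = m e x - x by rewrite add_lfunE opp_lfunE id_lfunE (lmulE mb).
have fI : (f @: I <= I)%VS.
  by apply/subvP => _ /memv_imgP[x xI ->]; rewrite fE memvB // m_derivedJr.
have : i \in (f @: I)%VS.
  rewrite inj_stable_limg // => x xI; rewrite fE => /eqP; rewrite subr_eq0 => /eqP.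
  exact: eI.
by case/memv_imgP => i' i'I ->; exists i'.
Qed.

(** [i] has the form [m e i' - i'], [ad z] commutes with [m e] on [D], and the projection takes the
    same value on [m e u] and on [u]. Error terms [z, i] therefore disappear under the
    projection. *)
Lemma p_br_I z i : i \in I -> m (br z i) e = 0.
Proof.
case/subI => i' i'I ->; rewrite (bBr brb) (bBl mb).
by rewrite [br z (m e i')]brC ?ID // [X in X - _]pe_fix ?subrr.
Qed.

Lemma br_e_J z : br z (J e) + br (J z) e \in I.
Proof. exact: br_J_derivedJ. Qed.

(* Hence z |-> J [z, e] + [J z, e] is a homomorphism to G + J G. *)
Lemma p_br w z :
  m (br w z) e = m (br w e) (br (J z) e) - m (br z e) (br (J w) e).
Proof.
rewrite -(pe_fix (brD w z)) -[m e _]/(br (J e) _).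
(* Jacobi for [J e], with [J e, w] replaced by [J w, e] and likewise for [z]; the errors [b] and [c]
   lie in [I], and the projection kills their brackets. *)
have bw := br_e_J w; have bz := br_e_J z.
set b := br w (J e) + _ in bw; set c := br z (J e) + _ in bz.
have -> : br (J e) (br w z) = br (br (J w) e) z - br b z + br w (br (J z) e) - br w c.
  rewrite (br_jacobi lieP) (br_anti lieP (J e) w) (br_anti lieP (J e) z).
  rewrite -addrA -(bBl brb) -(bBr brb) /b /c.
  by congr (br _ _ + br _ _); rewrite opprD addrCA subrr addr0.
have dG k : br k e \in G := brG_e k.
rewrite !(bDl mb, bNl mb) (br_anti lieP b) (bNl mb) (p_br_I z bw) (p_br_I w bz).
rewrite !oppr0 ?addr0 (br_anti lieP _ z) !(br_Gx _ (dG _)) (bNl mb) addrC.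
by rewrite !(G_e (br_G _ (dG _))); congr (_ - _); apply: GC.
Qed.

Definition rad_pred z := nil (br z e) /\ nil (br (J z) e).

Lemma rad_exists : exists r : {vspace V}, forall z, (z \in r) <-> rad_pred z.
Proof.
have nil0 : nil 0 by exists 0.
have nilG a x y : x \in G -> y \in G -> nil x -> nil y -> nil (a *: x + y).
  move=> xG yG xn yn; apply: (nilpD calgG) => //; first exact: memvZ.
  exact: (nilpZ calgG).
apply: vspace_of_pred => [|a x y [x1 x2] [y1 y2]].
  by rewrite /rad_pred linear0 (b0l brb).
by rewrite /rad_pred linearP !(bDl brb) !(bZl brb); split; apply: nilG => //; exact: brG_e.
Qed.

Section WithRadical.
Variable r : {vspace V}.
Hypothesis rP : forall z, (z \in r) <-> rad_pred z.

Lemma nilG_mull x y : x \in G -> y \in G -> nil x -> nil (m x y).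
Proof. exact: (nilpMl calgG). Qed.

Lemma rad_J z : z \in r -> J z \in r.
Proof.
move/rP => [zn Jzn]; apply/rP; split=> //.
by rewrite JJ (bNl brb); apply: (nilpN calgG).
Qed.

Lemma p_br_rad w z : z \in r -> nil (m (br w z) e).
Proof.
move/rP => [zn Jzn]; rewrite p_br.
have dG k : br k e \in G := brG_e k.
apply: (nilpB calgG); try exact: br_G.
  by apply: (nilpMr calgG).
exact: nilG_mull.
Qed.

Lemma rad_D u : u \in D -> nil (m u e) -> u \in r.
Proof.
by move=> uD un; apply/rP; split=> //; rewrite (br_DD lieP solvP uD eD); exists 0.
Qed.

Lemma rad_ideal : J_ideal br J fullv r.
Proof.
split; [exact: subvf | | exact/J_invP/rad_J].
by apply/lie_spanP => // w z _ zr; apply: rad_D => //; apply: p_br_rad.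
Qed.

Let commuting (f : 'End(V)) :=
  [/\ forall x v, v \in D -> f (m x v) = m x (f v),
      forall v, v \in D -> f v \in D & forall v, v \in I -> f v \in I].

(* Composing a suitable product of the commuting operators [m x], nilpotent
   modulo [I], kills all of them on [T] without killing [T]. *)
Lemma nilp_common_kernel (T : {vspace V}) (s : seq V) :
  (T <= D)%VS -> {subset s <= D} -> ~~ (T <= I)%VS ->
  (forall x, x \in s -> exists k, forall y, y \in D -> iter k (m x) y \in I) ->
  exists f, [/\ commuting f, ~~ (f @: T <= I)%VS &
    forall x t, x \in s -> t \in T -> m x (f t) \in I].
Proof.
move=> /subvP TD + TI; elim: s => [|x s IHs] sD snil.
  exists \1%VF; split=> //; last by rewrite lim1g.
  by split=> [x v _|v|v]; rewrite !id_lfunE.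
have sub z : z \in s -> z \in x :: s by move=> zs; rewrite inE zs orbT.
have xD : x \in D by apply: sD; rewrite mem_head.
have [f [fc fT fs]] : exists f, [/\ commuting f, ~~ (f @: T <= I)%VS &
    forall x t, x \in s -> t \in T -> m x (f t) \in I].
  by apply: IHs => z /sub; [apply: sD | apply: snil].
have [k xk] := snil x (mem_head _ _).
have {xk} : forall t, t \in T -> iter k (m x) (f t) \in I.
  by move=> t tT; apply: xk; case: fc => _ + _; apply; apply: TD.
elim: k f fc fT fs => [|k IHk] f fc fT fs xk.
  by case/negP: fT; apply/subvP => _ /memv_imgP[t tT ->]; apply: xk.
have [xf|] := pselect (forall t, t \in T -> m x (f t) \in I).
  by exists f; split=> // z t; rewrite inE => /orP[/eqP->|]; [apply: xf | apply: fs].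
move/existsNP => [t0 /not_implyP[t0T xt0]].
have gE v : (lmul m x \o f)%VF v = m x (f v) by rewrite comp_lfunE (lmulE mb).
have [fm fD fI] := fc.
apply: (IHk (lmul m x \o f)%VF).
- split=> [z v vD|v vD|v vI]; rewrite !gE.
  + by rewrite fm // mD_CA //; apply: fD.
  + exact: brD.
  + by apply: m_derivedJr => //; apply: fI.
- by apply/subvPn; exists (m x (f t0)); [rewrite -gE memv_img | apply/negP].
- move=> z t zs tT; rewrite gE mD_CA ?fD ?TD //.
  by apply: m_derivedJr => //; apply: fs.
- by move=> t tT; rewrite gE -iterSr; apply: xk.
Qed.

(** [x] is split along the projection: [m x e] is nilpotent by the definition of the radical, and
    [e] annihilates [x - m x e] modulo [I], so [eN] applies. *)
Lemma rad_nilp_mod x : x \in r -> x \in D ->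
  (exists k, forall y, y \in D -> iter k (m (m x e)) y \in I) /\
  (exists k, forall y, y \in D -> iter k (m (x - m x e)) y \in I).
Proof.
move=> xr xD; have xeD : m x e \in D := brD _ _.
have xeG : m x e \in G := brG_e _.
have [_ [j xej]] := (rP x).1 xr.
split; apply: (nilp_mod_iter lieP cplxP solvP) => //; rewrite ?memvB //.
  by exists j; rewrite [X in X \in _]xej mem0v.
by apply: eN; rewrite ?memvB // (bBr mb) (Ge xeG) mD_derivedJ.
Qed.

Lemma br_JDJD x y : x \in D -> y \in D -> br (J x) (J y) \in I.
Proof.
move=> xD yD; have /eqP := cplx_integrable cplxP x y.
rewrite (br_DD lieP solvP xD yD) add0r subr_eq0 => /eqP<-.
rewrite (br_anti lieP x) linearN -linearB; apply: (J_derivedJ cplxP).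
exact: mD_derivedJ.
Qed.

(** Let [W] in [r] equal its J-derived space, so W = T + J T with T = [W, W]. If [T] is in [I], then
    [W] lies in the abelian [D] and vanishes. Otherwise some [f] commuting with the products has f T
    not inside [I], while [m x (f t)] is in [I] for all [x], [t] in [T]. But [T] is spanned by sums
    of products from [T] and elements of [I], so f T is in [I] after all. *)
Lemma rad_solvable : J_solvable br J r.
Proof.
have [_ rid Jr] := rad_ideal.
apply: (J_solvableP lieP) => [|W Wr WE].
  apply/(J_derivedP lieP cplxP) => // x y _ yr.
  by have /(lie_spanP lieP) := rid; apply=> //; apply: memvf.
pose T := lie_span br W W.
have TD : (T <= D)%VS by apply/(lie_spanP lieP) => x y _ _; apply: brD.
have TW : (T <= W)%VS by rewrite -WE addvSl.
have Tr x : x \in T -> x \in r by move=> /(subvP TW)/(subvP Wr).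
suff TI : (T <= I)%VS.
  have WI : (W <= I)%VS.
    rewrite -WE subv_add TI; apply/subvP => x; rewrite (mem_imgJ cplxP).
    by move/(subvP TI)/(J_derivedJ cplxP); rewrite JJ memvN.
  apply/eqP; rewrite -subv0 -WE; apply/(J_derivedP lieP cplxP).
    by rewrite /J_invariant limg_line linear0.
  by move=> x y /(subvP WI)/ID xD /(subvP WI)/ID yD; rewrite memv0 (br_DD lieP).
apply/negPn/negP => TI.
pose b1 := [seq m b e | b <- vbasis T]; pose b2 := [seq b - m b e | b <- vbasis T].
have TbD b : b \in tval (vbasis T) -> b \in D by move/vbasis_mem/(subvP TD).
have [|x|f [[fm fD fI] fT fs]] := @nilp_common_kernel T (b1 ++ b2) TD _ TI.
- by move=> x; rewrite mem_cat => /orP[]/mapP[b bT ->]; rewrite ?memvB ?brD ?TbD.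
- rewrite mem_cat => /orP[]/mapP[b bT ->];
  by have [] := rad_nilp_mod (Tr _ (vbasis_mem bT)) (TbD _ bT).
have fTI x t : x \in T -> t \in T -> m x (f t) \in I.
  move=> xT tT; rewrite (coord_vbasis xT) (bsuml mb); apply: memv_suml => i _.
  have bT : (vbasis T)`_i \in tval (vbasis T) by rewrite mem_nth ?size_tuple.
  rewrite (bZl mb) memvZ //; move: (_`_i) bT => b bT.
  rewrite -[b](subrK (m b e)) (bDl mb) memvD //; apply: fs => //.
    by rewrite mem_cat; apply/orP; right; apply: map_f.
  by rewrite mem_cat; apply/orP; left; apply: map_f.
case/negP: fT; apply/subvP => _ /memv_imgP[t tT ->]; rewrite memv_preim.
move: t tT; apply/subvP/(lie_spanP lieP) => x y; rewrite -WE => xW yW.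
have [x1 [x2 [x1T x2T ->]]] := mem_plusJP _ _ _ xW.
have [y1 [y2 [y1T y2T ->]]] := mem_plusJP _ _ _ yW.
have TD' := subvP TD.
rewrite -memv_preim (bDl brb) !(bDr brb) (br_DD lieP solvP (TD' _ x1T) (TD' _ y1T)) add0r.
rewrite (br_anti lieP x1) -/(m y2 x1) -/(m x2 y1) !linearD linearN /=.
rewrite (fm y2 x1) ?(fm x2 y1) ?TD' //.
apply: memvD; first by rewrite memvN fTI.
by apply: memvD; [apply: fTI | apply: fI; apply: br_JDJD; apply: TD'].
Qed.

Lemma rad_max k : J_ideal br J fullv k -> J_solvable br J k -> (k <= r)%VS.
Proof.
move=> [_ /(lie_spanP lieP) kid /J_invP Jk] ksolv; apply/subvP => z zk.
have ke y : y \in k -> nil (br y e).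
  move=> yk; have yek : br y e \in k.
    by rewrite (br_anti lieP) memvN; apply: kid => //; apply: memvf.
  by apply: (J_solvable_nilp lieP ksolv) => //; apply: Jk.
by apply/rP; split; apply: ke => //; apply: Jk.
Qed.

Lemma is_rad : is_J_radical br J r.
Proof. by split; [exact: rad_ideal | exact: rad_solvable | exact: rad_max]. Qed.

Lemma RadE : Rad br J = r.
Proof.
apply: xget_unique; first exact: is_rad.
move=> r' [id' solv' max']; apply: subv_anti.
by rewrite (rad_max id' solv') (max' _ rad_ideal rad_solvable).
Qed.

Section Levi.
Variables (n : nat) (ew yw : 'I_n -> V).
Hypothesis wG : wedderburn m G ew yw.

Local Notation S := (wspan ew yw).

Definition levi : {vspace V} := (S + J @: S)%VS.

Let SG x : x \in S -> x \in G.
Proof. exact/subvP/(wspan_subB wG). Qed.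

Let Scl := wspan_closed calgG wG.

Lemma wedd_unit_e : \sum_i ew i = e.
Proof. by apply: (wedd_unitE calgG wG eG); apply: Ge. Qed.

Lemma eS : e \in S.
Proof. by rewrite -wedd_unit_e; apply: wedd_unitB. Qed.

Lemma levi_br s t s' t' : s \in S -> t \in S -> s' \in S -> t' \in S ->
  br (s + J t) (s' + J t') = m t s' - m t' s.
Proof.
move=> sS tS s'S t'S; rewrite (bDl brb) !(bDr brb).
rewrite (br_DD lieP solvP) ?GD ?SG // add0r br_JGJG ?SG // addr0.
by rewrite (br_anti lieP s) addrC.
Qed.

(** Bracketing an element and its image under [J] with [e] recovers both of its coordinates in S + J
    S. *)
Lemma levi_brr s t : s \in S -> t \in S -> br (s + J t) e = t.
Proof.
move=> sS tS; have := levi_br sS tS eS (mem0v _).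
by rewrite linear0 addr0 (b0l mb) subr0 => ->; apply/G_e/SG.
Qed.

Lemma levi_J s t : J (s + J t) = - t + J s.
Proof. by rewrite linearD /= JJ addrC. Qed.

Lemma levi_subalgebra : J_subalgebra br J levi.
Proof.
split.
  apply/(lie_spanP lieP) => x y /mem_plusJP[s [t [sS tS ->]]].
  case/mem_plusJP => s' [t' [s'S t'S ->]]; rewrite levi_br //.
  by apply: (subvP (addvSl _ _)); rewrite memvB // Scl.
apply/J_invP => _ /mem_plusJP[s [t [sS tS ->]]]; rewrite levi_J.
by apply/mem_plusJP; exists (- t), s; rewrite memvN.
Qed.

Lemma levi_cap : (levi :&: r)%VS = 0%VS.
Proof.
apply/eqP; rewrite -subv0; apply/subvP => x; rewrite memv_cap memv0.
case/andP => /mem_plusJP[s [t [sS tS ->]]] /rP[].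
rewrite levi_J !levi_brr ?memvN // => tn sn.
rewrite (wspan_reduced calgG wG tS tn) (wspan_reduced calgG wG sS sn).
by rewrite linear0 addr0.
Qed.

Lemma levi_add : (levi + r)%VS = fullv.
Proof.
apply/vspaceP => z; rewrite memvf.
have [s sS zs] := wedd_span wG (brG_e z).
have [t tS zt] := wedd_span wG (brG_e (J z)).
have hx : t + J s \in levi by apply/mem_plusJP; exists t, s.
rewrite -[z](subrK (t + J s)) addrC memv_add //; apply/rP; split.
  by rewrite (bBl brb) levi_brr.
by rewrite linearB /= levi_J (bBl brb) levi_brr ?memvN.
Qed.

Lemma levi_semidirect : semidirect br J levi r.
Proof.
split; [exact: levi_subalgebra | exact: rad_ideal | exact: levi_add | exact: levi_cap].
Qed.

(** For [y] in a J-solvable ideal, [y, e] lies in that ideal and in [S], is nilpotent and hence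
    zero; the same for [J y] kills both coordinates of [y]. *)
Lemma levi_semisimple : J_semisimple br J levi.
Proof.
split=> [|k [/subvP kh /(lie_spanP lieP) kid /J_invP Jk] ksolv].
  exact: levi_subalgebra.
have eh : e \in levi by apply: (subvP (addvSl _ _)); apply: eS.
have ke y : y \in k -> br y e = 0.
  move=> yk; have yek : br y e \in k.
    by rewrite (br_anti lieP) memvN; apply: kid.
  have yS : br y e \in S.
    by have /mem_plusJP[s [t [sS tS ->]]] := kh _ yk; rewrite levi_brr.
  apply: (wspan_reduced calgG wG yS).
  by apply: (J_solvable_nilp lieP ksolv) => //; apply: Jk.
apply/eqP; rewrite -subv0; apply/subvP => x xk; rewrite memv0.
have := ke _ (Jk _ xk); have := ke _ xk.
have /mem_plusJP[s [t [sS tS ->]]] := kh _ xk.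
rewrite levi_J !levi_brr ?memvN // => -> ->.
by rewrite linear0 addr0.
Qed.

(** * Uniqueness of the complement *)

Section Uniqueness.
Variable h : {vspace V}.
Hypotheses (hsub : J_subalgebra br J h) (hr : (h + r)%VS = fullv).
Hypothesis hr0 : (h :&: r)%VS = 0%VS.

Let f := daddv_pi h r.

Let fh x : f x \in h. Proof. exact: memv_pi. Qed.

Let fr x : f x - x \in r.
Proof.
rewrite -memvN opprB -{1}[x](daddv_pi_add hr0) ?hr ?memvf // addrC addKr.
exact: memv_pi.
Qed.

Let fE x y : y \in h -> y - x \in r -> f x = y.
Proof.
move=> yh yxr; apply/eqP; rewrite -subr_eq0 -memv0 -hr0 memv_cap memvB //=.
by have := memvB (fr x) yxr; rewrite opprB addrA subrK.
Qed.

Let fm x y : f (m x y) = m (f x) (f y).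
Proof.
have [/(lie_spanP lieP) hcl /J_invP hJ] := hsub.
have [_ /(lie_spanP lieP) rid Jr] := rad_ideal.
apply: fE; first by apply: hcl => //; apply: hJ.
have -> : m (f x) (f y) - m x y = m (f x) (f y - y) + m (f x - x) y.
  by rewrite (bBr mb) (bBl mb) subrKA.
rewrite memvD //; first by apply: rid => //; apply: memvf.
by rewrite /Jmul (br_anti lieP) memvN; apply: rid; [exact: memvf | apply: rad_J].
Qed.

(** With [g = f e], [m g e] is an idempotent of [G] congruent to [e] modulo nilpotents, hence equal
    to [e]. Then [x = g - e] satisfies [m x e = 0] and [x = m e x + m x x]. Here [m e x] is in [I],
    so [x] agrees with its repeated squares modulo [I], and [eN] puts [x] in [I]. There [m x x = 0],
    so [m e x = x] and [x = 0]. *)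
Lemma complement_e : f e = e.
Proof.
have ffe : m (f e) (f e) = f e by rewrite -fm ee.
have [g gE] : exists g, g = f e by exists (f e).
rewrite -gE in ffe *; have gD : g \in D by rewrite -ffe; apply: brD.
have gr : g - e \in r by rewrite gE fr.
have [q qE] : exists q, q = m g e by exists (m g e).
have qG : q \in G by rewrite qE; apply: brG_e.
have qq : m q q = q.
  have gq : m g q = m q q by rewrite [LHS]br_Gx // -[br (J g) e]/(m g e) -qE.
  rewrite -gq; apply/eqP; rewrite -subr_eq0; apply/eqP/GI.
    by rewrite memvB //; apply: br_G.
  have := m_assoc_mod lieP cplxP solvP gD gD eD.
  by rewrite ffe -qE.
have qe : q = e.
  apply: (idem_eq calgG) => //; first exact: eG.
  have [_] := (rP _).1 gr; rewrite -[br _ _]/(m (g - e) e) (bBl mb) ee.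
  by rewrite qE.
rewrite qe in qE; have [x xE] : exists x, x = g - e by exists (g - e).
have xD : x \in D by rewrite xE memvB.
have gex : g = e + x by rewrite xE addrC subrK.
have xe : m x e = 0 by rewrite xE (bBl mb) ee -qE subrr.
have xx : x = m e x + m x x.
  apply: (addrI e); rewrite -gex -{1}ffe gex (bDl mb) !(bDr mb) ee xe add0r.
  by rewrite addrA.
have exI : m e x \in I.
  by have := mD_derivedJ lieP cplxP eD xD; rewrite xe subr0.
have xI : x \in I.
  have [j xj] := eN xD exI.
  suff : iter j (sq m) x - x \in I by move=> /(memvB xj); rewrite opprB addrC subrK.
  elim: j {xj} => [|j IHj] /=; first by rewrite subrr mem0v.
  set s := iter j (sq m) x in IHj *.
  have sD : s \in D by apply: iter_sqD.
  have xIx : m x x - x \in I by rewrite -memvN opprB {1}xx addrK.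
  have sI : m s (s - x) \in I by apply: m_derivedJr.
  have sxx : m s x = m x x by apply: (m_congl lieP cplxP solvP).
  by have := memvD sI xIx; rewrite (bBr mb) sxx subrKA.
rewrite (_ : x = 0) ?addr0 in gex => //.
by apply: (eI xI); rewrite {2}xx (m_derivedJl lieP cplxP solvP xI xD) addr0.
Qed.

Let fS_G s : s \in S -> f s \in G.
Proof.
move=> sS; have es : m e s = s by apply/Ge/SG.
have fsE : f s = m e (f s) by rewrite -{1}es fm complement_e.
by rewrite memG -fsE eqxx andbT fsE; apply: brD.
Qed.

Let fS_nil s : s \in S -> nil (f s - s).
Proof.
move=> sS; have [_] := (rP _).1 (fr s).
by rewrite -[br _ _]/(m (f s - s) e) G_e // memvB ?fS_G // SG.
Qed.

Lemma complement_levi : h = levi.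
Proof.
have [_ /J_invP hJ] := hsub.
have eiS i : ew i \in S by apply: mem_wspan_e.
have yiS i : yw i \in S by apply: mem_wspan_y.
have fei i : f (ew i) = ew i.
  have eei : m (ew i) (ew i) = ew i by rewrite (wedd_ee wG) eqxx.
  apply: (idem_eq calgG) => //; [exact: fS_G | exact: SG | | exact: fS_nil].
  by rewrite -fm eei.
have fyi i : f (yw i) = yw i.
  apply: (wedd_sqrt_uniq calgG wG); first exact: fS_G.
  - by rewrite -{1}fei -fm (wedd_ey wG).
  - by move=> ->; rewrite linear0.
  - by move=> y2; rewrite -fm y2 linearN /= fei.
  - exact: fS_nil.
have Sh : (S <= h)%VS.
  by apply: wspan_sub => i; [rewrite -fei | rewrite -fyi]; apply: fh.
have lh : (levi <= h)%VS.
  rewrite subv_add Sh; apply/subvP => x; rewrite (mem_imgJ cplxP) => /(subvP Sh)/hJ.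
  by rewrite JJ memvN.
apply: subv_anti; rewrite lh andbT; apply/subvP => x xh.
have /memv_addP[a al [b br_ xE]] : x \in (levi + r)%VS by rewrite levi_add memvf.
have : b \in (h :&: r)%VS.
  rewrite memv_cap br_ andbT -[b](addKr a) -xE addrC memvB //.
  exact: (subvP lh).
by rewrite hr0 memv0 => /eqP b0; rewrite xE b0 addr0.
Qed.

End Uniqueness.
End Levi.

End WithRadical.

(** Uniqueness is stated among all complements, which makes it directly applicable to the choice
    made by [J_levi] in the quotient. *)
Theorem levi_exists_unique : exists n (ew yw : 'I_n -> V),
  [/\ wedderburn m G ew yw, e = \sum_i ew i,
      J_semisimple br J (levi ew yw), semidirect br J (levi ew yw) (Rad br J) &
      forall h, semidirect br J h (Rad br J) -> h = levi ew yw].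
Proof.
have [r rP] := rad_exists.
have [n [ew [yw wG]]] := wedderburn_exists calgG.
exists n, ew, yw; rewrite (RadE rP); split=> //.
- by rewrite (wedd_unit_e wG).
- exact: levi_semisimple wG.
- exact: (levi_semidirect rP wG).
- by move=> h [hsub _ hr hr0]; apply: (complement_levi rP wG).
Qed.

End Core.

(** * Mean curvature of semisimple affine algebras *)

Section Trace.
Variables (R : realType) (V : vectType R).

Lemma lftraceD (f g : 'End(V)) : lftrace (f + g) = lftrace f + lftrace g.
Proof. by rewrite /lftrace /endo_mx linearD mxtraceD. Qed.

Lemma lftraceN (f : 'End(V)) : lftrace (- f) = - lftrace f.
Proof. by rewrite /lftrace /endo_mx linearN raddfN. Qed.

Lemma lftrace0 : lftrace (0 : 'End(V)) = 0.
Proof. by rewrite /lftrace /endo_mx linear0 mxtrace0. Qed.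

Lemma endo_mxM (f g : 'End(V)) : endo_mx (f \o g)%VF = endo_mx g *m endo_mx f.
Proof. by rewrite /endo_mx (mxof_comp _ _ (vbasisP _)). Qed.

Lemma lftraceC (f g : 'End(V)) : lftrace (f \o g)%VF = lftrace (g \o f)%VF.
Proof. by rewrite /lftrace !endo_mxM mxtrace_mulC. Qed.

(** In a full-rank factorisation A = C R, idempotency forces R C = 1, an identity matrix of size the
    rank of [A]. *)
Lemma mxtrace_idem n (A : 'M[R]_n) : A *m A = A -> \tr A = (\rank A)%:R.
Proof.
move=> AA; rewrite -{1}(mulmx_base A) mxtrace_mulC.
have -> : row_base A *m col_base A = 1%:M; last by rewrite mxtrace1.
apply: (row_full_inj (col_base_full A)); apply: (row_free_inj (row_base_free A)).
by rewrite /= mulmx1 mulmxA -[LHS]mulmxA !mulmx_base.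
Qed.

Lemma lftrace_idem0 (f : 'End(V)) : (f \o f)%VF = f -> lftrace f = 0 -> f = 0.
Proof.
move=> ff; have : endo_mx f *m endo_mx f = endo_mx f by rewrite -endo_mxM ff.
move/mxtrace_idem; rewrite /lftrace => -> /eqP; rewrite pnatr_eq0 mxrank_eq0.
by rewrite mxof_eq0 ?vbasisP // => /eqP.
Qed.

End Trace.

(** Coordinates for a sum of copies of aff(R) and aff(C): [S] is a product of copies of R and C,
    [J S] acts on it by multiplication, and both are abelian. *)
Record aff_wedderburn (R : realType) (V : vectType R) (br : V -> V -> V)
    (J : 'End(V)) n (ew yw : 'I_n -> V) : Prop := AffWedderburn {
  aff_lie : lie_bracket br;
  aff_cplx : complex_structure br J;
  aff_calg : calg (Jmul br J) (wspan ew yw);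
  aff_wedd : wedderburn (Jmul br J) (wspan ew yw) ew yw;
  aff_full : forall x, exists s t,
    [/\ s \in wspan ew yw, t \in wspan ew yw & x = s + J t];
  aff_br : forall s t s' t', s \in wspan ew yw -> t \in wspan ew yw ->
    s' \in wspan ew yw -> t' \in wspan ew yw ->
    br (s + J t) (s' + J t') = Jmul br J t s' - Jmul br J t' s
}.

Section AffineMeanCurvature.
Variables (R : realType) (V : vectType R) (br : V -> V -> V) (J : 'End(V)).
Variables (n : nat) (ew yw : 'I_n -> V).
Hypothesis aff : aff_wedderburn br J ew yw.

Local Notation S := (wspan ew yw).
Local Notation m := (Jmul br J).
Local Notation e := (\sum_i ew i).

Let lieP := aff_lie aff.
Let cplxP := aff_cplx aff.
Let wS := aff_wedd aff.
Let mS := aff_calg aff.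
Let brb := lie_bilin lieP.
Let mb := m_bilin J lieP.
Let JJ := JJ cplxP.

Lemma adE x y : ad br x y = br x y. Proof. exact: (lmulE brb). Qed.

Lemma adN x : ad br (- x) = - ad br x.
Proof. by apply/lfunP => y; rewrite opp_lfunE !adE (bNl brb). Qed.

Lemma adB x y : ad br (x - y) = ad br x - ad br y.
Proof. by apply/lfunP => z; rewrite add_lfunE opp_lfunE !adE (bBl brb). Qed.

Lemma killingC x y : killing br x y = killing br y x.
Proof. exact: lftraceC. Qed.

Lemma killingNl x y : killing br (- x) y = - killing br x y.
Proof. by rewrite /killing adN comp_lfunNl lftraceN. Qed.

Lemma killingNr x y : killing br x (- y) = - killing br x y.
Proof. by rewrite killingC killingNl killingC. Qed.

Lemma killingBl x y z : killing br (x - y) z = killing br x z - killing br y z.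
Proof. by rewrite /killing adB comp_lfunDl comp_lfunNl lftraceD lftraceN. Qed.

Lemma aff_brS x y : br x y \in S.
Proof.
have [s [t [sS tS ->]]] := aff_full aff x.
have [s' [t' [s'S t'S ->]]] := aff_full aff y.
by rewrite (aff_br aff) // memvB //; apply: (calg_closed mS).
Qed.

Lemma aff_brSS x y : x \in S -> y \in S -> br x y = 0.
Proof.
move=> xS yS; have := aff_br aff xS (mem0v _) yS (mem0v _).
by rewrite linear0 !addr0 !(b0l mb) subrr.
Qed.

Lemma aff_brJ t s' t' : t \in S -> s' \in S -> t' \in S ->
  br (J t) (s' + J t') = m t s'.
Proof.
move=> tS s'S t'S; have := aff_br aff (mem0v _) tS s'S t'S.
by rewrite add0r (b0r mb) subr0.
Qed.

Lemma aff_eS : e \in S. Proof. exact: wedd_unitB. Qed.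

Lemma aff_unit s : s \in S -> m e s = s. Proof. exact: (wspan_unit mS wS). Qed.

(** [ad (J e)] is the identity on [S], which contains every bracket. *)
Lemma killing_e w : killing br (J e) w = lftrace (ad br w).
Proof.
congr lftrace; apply/lfunP => v; rewrite comp_lfunE !adE -/(m e _).
exact/aff_unit/aff_brS.
Qed.

Lemma killing_S x w : x \in S -> killing br x w = 0.
Proof.
move=> xS; rewrite -[RHS](lftrace0 V); congr lftrace; apply/lfunP => v.
by rewrite comp_lfunE !adE zero_lfunE aff_brSS // aff_brS.
Qed.

(** The factor 2 compensates the average: the other term pairs [- e] with [J w], and [S] lies in the
    kernel of the Killing form. *)
Lemma killing11_e w : killing11 br J (J e *+ 2) w = lftrace (ad br w).
Proof.
rewrite /killing11 !mulr2n.
have kD x y z : killing br (x + y) z = killing br x z + killing br y z.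
  by rewrite -[y]opprK killingBl !killingNl opprK.
rewrite linearD /= !kD !JJ killing_e !killingNl !killing_S ?aff_eS //.
rewrite oppr0 !addr0; by field.
Qed.

Lemma killing11_J u w : killing11 br J (J u) w = - killing11 br J u (J w).
Proof.
by rewrite /killing11 !JJ killingNl killingNr -mulrN opprB addrC.
Qed.

(** Test against [J t], where [m b t = f] is a nonzero idempotent. The composed adjoints give
    [ad (J f)], an idempotent whose trace is its rank, and the other term vanishes since [t] is in
    [S]. *)
Lemma killing11_nondegJ a b : a \in S -> b \in S ->
  (forall w, killing11 br J (a + J b) w = 0) -> b = 0.
Proof.
move=> aS bS k0; apply/eqP/negPn/negP => b0.
have [t [f [tS fS f0 ff bt]]] := wspan_inv mS wS bS b0.
have adf : (ad br (J f) \o ad br (J f))%VF = ad br (J f).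
  apply/lfunP => v; rewrite comp_lfunE !adE.
  have [s' [t' [s'S t'S ->]]] := aff_full aff v.
  by rewrite aff_brJ // -/(m f _) (mA mS) // ff.
have k1 : killing br (a + J b) (J t) = lftrace (ad br (J f)).
  congr lftrace; apply/lfunP => v; rewrite comp_lfunE !adE.
  rewrite (bDl brb) aff_brSS ?aff_brS // add0r.
  have [s' [t' [s'S t'S ->]]] := aff_full aff v.
  by rewrite !aff_brJ // -/(m b _) (mA mS) // bt.
have := k0 (J t); rewrite /killing11 k1 JJ killingNr killingC (killing_S _ tS) oppr0 addr0.
move/eqP; rewrite mulf_eq0 invr_eq0 pnatr_eq0 /= => /eqP/(lftrace_idem0 adf) adf0.
by case/eqP: f0; rewrite -ff -[m f f]/(br (J f) f) -adE adf0 zero_lfunE.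
Qed.

Lemma killing11_nondeg u : (forall w, killing11 br J u w = 0) -> u = 0.
Proof.
have [a [b [aS bS ->]]] := aff_full aff u => k0.
rewrite (killing11_nondegJ aS bS k0) linear0 addr0.
have b'S : - b \in S by rewrite memvN.
apply: (killing11_nondegJ b'S aS) => w; have := killing11_J (a + J b) w.
by rewrite k0 oppr0 linearD /= JJ addrC.
Qed.


(** Checked on the frames, brackets between different summands being zero. Traces of adjoints are
    invariant under automorphisms, so [s] drops out of the equation defining the mean curvature
    vector. *)
Lemma aff_involution_morph s : is_aff_involution br J s ->
  (forall v, s (s v) = v) /\ (forall x y, s (br x y) = br (s x) (s y)).
Proof.
case=> k [I [dI sumI idI frI]].
have Isub i x y : y \in I i -> br x y \in I i.
  have [_ /(lie_spanP lieP) H _] := idI i; by apply: H; apply: memvf.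
have frames i : exists X, [/\ (I i <= <<X>>)%VS, forall x, x \in X -> s (s x) = x,
    {in X, forall x, s x \in I i} &
    {in X &, forall x y, s (br x y) = br (s x) (s y)}].
  have [[X [[bas JXX] sX sJX]]|[X [Y [frXY sX sJX sY sJY]]]] := frI i.
    exists [:: X; J X]; have memI := basis_mem bas; have spI := span_basis bas.
    have XJX : br X (J X) = - X by rewrite (br_anti lieP) JXX.
    split=> [|x|x|x y]; rewrite ?spI ?subvv // !inE.
    - by case/orP => /eqP->; rewrite ?sX ?sJX ?sX ?sJX.
    - by case/orP => /eqP->; rewrite ?sX ?sJX memI // !inE eqxx ?orbT.
    by case/orP => /eqP-> /orP[] /eqP->;
      rewrite ?sX ?sJX ?(lie_alt lieP) ?JXX ?XJX ?linear0 ?linearN /= ?sX.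
  case: frXY => bas JXX [JXY JYX] JYY [XY JXJY].
  exists [:: X; J X; Y; J Y]; have memI := basis_mem bas; have spI := span_basis bas.
  have XJX : br X (J X) = - X by rewrite (br_anti lieP) JXX.
  have YJX : br Y (J X) = - Y by rewrite (br_anti lieP) JXY.
  have XJY : br X (J Y) = - Y by rewrite (br_anti lieP) JYX.
  have YJY : br Y (J Y) = X by rewrite (br_anti lieP) JYY opprK.
  have YX : br Y X = 0 by rewrite (br_anti lieP) XY oppr0.
  have JYJX : br (J Y) (J X) = 0 by rewrite (br_anti lieP) JXJY oppr0.
  have memn q : (q < 4)%N -> [:: X; J X; Y; J Y]`_q \in I i.
    by move=> q4; apply/memI/mem_nth.
  have := (memn 3 isT, memn 2 isT, memn 1 isT, memn 0 isT) => /= -[[[JYI YI] JXI] XI].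
  have s0 : s 0 = 0 by rewrite linear0.
  have sN x : s (- x) = - s x by rewrite linearN.
  have br0 := lie_alt lieP; have bN := (bNl brb, bNr brb).
  split=> [|x|x|x y]; rewrite ?spI ?subvv //;
    move: (J X) (J Y) JXX JXY JYX JYY JXJY XJX YJX XJY YJY JYJX sX sJX sY sJY JYI YI JXI XI
      => A B AX AY BX BY AB XA YA XB YB BA sX sA sY sB BI YI AI XI; rewrite !inE.
  - by case/or4P => /eqP->; rewrite ?(sX, sA, sY, sB, sN) ?opprK.
  - by case/or4P => /eqP->; rewrite ?(sX, sA, sY, sB) ?memvN.
  by case/or4P => /eqP-> /or4P[] /eqP->; rewrite ?(sX, sA, sY, sB) ?bN
    ?(br0 X, br0 A, br0 Y, br0 B, AX, AY, BX, BY, AB, XA, YA, XB, YB, BA, XY, YX)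
    ?(sN, s0) ?(sX, sA, sY, sB) ?opprK ?oppr0.
have sI i x : x \in I i -> s x \in I i.
  have [X [IX _ sX _]] := frames i; move=> /(subvP IX) xX.
  rewrite memv_preim; apply: (subvP _ _ xX); apply/span_subvP => u uX.
  by rewrite -memv_preim sX.
have sumP x : exists2 v, forall i, v i \in I i & x = \sum_i v i.
  have /memv_sumP[v vI ->] : x \in (\sum_i I i)%VS by rewrite sumI memvf.
  by exists v => // i; apply: vI.
have zero i j x : i != j -> x \in I i -> x \in I j -> x = 0.
  move=> ij xi xj; apply/eqP; rewrite -memv0.
  have /directv_sumP/(_ i isT) <- := dI.
  rewrite memv_cap xi /=; apply: (subvP (sumv_sup j _ (subvv _))) => //.
  by rewrite eq_sym.
split=> [v|x y].
  have [u uI ->] := sumP v; rewrite !linear_sum; apply: eq_bigr => i _ /=.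
  have [X [IX ssX _ _]] := frames i.
  have : u i \in lker (s \o s - \1)%VF.
    apply: (subvP _ _ (subvP IX _ (uI i))); apply/span_subvP => z zX.
    by rewrite memv_ker add_lfunE opp_lfunE comp_lfunE id_lfunE ssX // subrr.
  by rewrite memv_ker add_lfunE opp_lfunE comp_lfunE id_lfunE subr_eq0 => /eqP.
pose f x y := s (br x y) - br (s x) (s y).
have fb : bilin f.
  split=> [z a u v|z a u v]; rewrite /f.
    rewrite linearP (bDl brb) (bZl brb) linearP /= (bDl brb) (bZl brb).
    by rewrite opprD addrACA scalerBr.
  by rewrite (bDr brb) (bZr brb) !linearP /= (bDr brb) (bZr brb) opprD addrACA scalerBr.
have fb' : bilin (fun x y => f y x) by split; [exact: bilinr fb | exact: bilinl fb].
suff : f x y = 0 by move/eqP; rewrite subr_eq0 => /eqP.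
have [u uI ->] := sumP x; have [v vI ->] := sumP y.
rewrite (bsuml fb) big1 // => i _; rewrite (bsumr fb) big1 // => j _.
have [ij|ij] := eqVneq i j; last first.
  have cross z w : z \in I i -> w \in I j -> br z w = 0.
    move=> zi wj; apply: (zero i j) => //; last exact: Isub.
    by rewrite (br_anti lieP) memvN Isub.
  by rewrite /f !cross ?sI // linear0 subrr.
have [X [IX _ _ morX]] := frames i.
have ux := subvP IX _ (uI i).
have vx : v j \in <<X>>%VS by apply: (subvP IX); rewrite ij.
have step z : z \in X -> f z (v j) = 0.
  move=> zX; have : v j \in lker (lmul f z).
    apply: (subvP _ _ vx); apply/span_subvP => w wX.
    by rewrite memv_ker (lmulE fb) /f morX // subrr.
  by rewrite memv_ker (lmulE fb) => /eqP.
have : u i \in lker (lmul (fun x y => f y x) (v j)).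
  apply: (subvP _ _ ux); apply/span_subvP => w wX.
  by rewrite memv_ker (lmulE fb') step.
by rewrite memv_ker (lmulE fb') => /eqP.
Qed.

Lemma lftrace_ad_morph (s : 'End(V)) v : (forall v, s (s v) = v) ->
  (forall x y, s (br x y) = br (s x) (s y)) ->
  lftrace (ad br (s v)) = lftrace (ad br v).
Proof.
move=> ss sbr; have -> : ad br (s v) = (s \o (ad br v \o s))%VF.
  by apply/lfunP => w; rewrite !comp_lfunE !adE sbr ss.
rewrite lftraceC; congr lftrace; apply/lfunP => w.
by rewrite !comp_lfunE ss.
Qed.

Lemma mean_curvature_aff : (exists s, is_aff_involution br J s) ->
  mean_curvature_ss br J = J e *+ 2.
Proof.
move=> exs; have sP : is_aff_involution br J (aff_involution br J).
  exact: (xgetPex 0 exs).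
have [ss sbr] := aff_involution_morph sP.
apply: xget_unique => [v|u uP].
  by rewrite /killing11s killing11_e lftrace_ad_morph.
apply/eqP; rewrite -subr_eq0; apply/eqP/killing11_nondeg => w.
have := uP (aff_involution br J w); rewrite /killing11s ss.
rewrite lftrace_ad_morph // -killing11_e /killing11 => uw.
by rewrite linearB !killingBl -addrACA -opprD mulrBr -uw subrr.
Qed.

(** * The decomposition into copies of aff(R) and aff(C) *)

Section Summands.

Let eS i : ew i \in S. Proof. exact: mem_wspan_e. Qed.
Let yS i : yw i \in S. Proof. exact: mem_wspan_y. Qed.
Let Si i : {vspace V} := (<[ew i]> + <[yw i]>)%VS.
Let eSi i : ew i \in Si i. Proof. exact/(subvP (addvSl _ _))/memv_line. Qed.
Let ySi i : yw i \in Si i. Proof. exact/(subvP (addvSr _ _))/memv_line. Qed.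

Lemma memSi i x : (x \in Si i) = (x \in S) && (m (ew i) x == x).
Proof.
apply/idP/andP => [|[xS /eqP <-]].
  case/memv_addP => _ /vlineP[a ->] [_ /vlineP[b ->] ->].
  rewrite (bDr mb) !(bZr mb) (wedd_ee wS) (wedd_ey wS) eqxx.
  by split=> //; apply: memvD; apply: memvZ.
have [a [b ->]] := wspan_comp mS wS i xS.
by apply: memvD; apply: memvZ.
Qed.

Let Scl := calg_closed mS.

Lemma aff_br_e s t : s \in S -> t \in S -> br (s + J t) e = t.
Proof.
move=> sS tS; have := aff_br aff sS tS aff_eS (mem0v _).
rewrite linear0 addr0 (b0l mb) subr0 => ->.
by rewrite (calg_comm mS) ?aff_unit ?aff_eS.
Qed.

Lemma aff_coord0 s t : s \in S -> t \in S -> s + J t = 0 -> s = 0 /\ t = 0.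
Proof.
move=> sS tS st0; have t0 : t = 0 by rewrite -(aff_br_e sS tS) st0 (b0l brb).
by move: st0; rewrite t0 linear0 addr0.
Qed.

(** Multiplying by the conjugate gives (a^2 + b^2) e. The second conclusion keeps [yw i], which may
    be zero. *)
Lemma wedd_line0 i a b : a *: ew i + b *: yw i = 0 -> a = 0 /\ b *: yw i = 0.
Proof.
move=> ab0; suff a0 : a = 0 by move: ab0; rewrite a0 scale0r add0r.
case: (wedd_yy wS i) => [y0|y2].
  move: ab0; rewrite y0 scaler0 addr0 => /eqP.
  by rewrite scaler_eq0 (negPf (wedd_e0 wS i)) orbF => /eqP.
have ye : m (yw i) (ew i) = yw i by rewrite (calg_comm mS) // (wedd_ey wS).
have /eqP : m (a *: ew i - b *: yw i) (a *: ew i + b *: yw i) = 0.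
  by rewrite ab0 (b0r mb).
rewrite (bBl mb) !(bDr mb) !(bZl mb) !(bZr mb) (wedd_ee wS) eqxx (wedd_ey wS) ye y2.
rewrite !scalerN !scalerA [b * a]mulrC opprB addrACA subrr addr0 -scalerDl -!expr2.
rewrite scaler_eq0 (negPf (wedd_e0 wS i)) orbF paddr_eq0 ?sqr_ge0 // sqrf_eq0.
by case/andP => /eqP.
Qed.

Let bl i := (Si i + J @: Si i)%VS.

Let Si_S i x : x \in Si i -> x \in S. Proof. by rewrite memSi => /andP[]. Qed.
Let Si_e i x : x \in Si i -> m (ew i) x = x. Proof. by rewrite memSi => /andP[_ /eqP]. Qed.

Lemma aff_summand_ideal i : J_ideal br J fullv (bl i).
Proof.
split; first exact: subvf.
  apply/(lie_spanP lieP) => x z _ /mem_plusJP[s [t [si ti ->]]].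
  have [s' [t' [s'S t'S ->]]] := aff_full aff x.
  have sS := Si_S si; have tS := Si_S ti.
  have idl u v : u \in S -> v \in Si i -> m u v \in Si i.
    move=> uS; rewrite !memSi => /andP[vS /eqP ev].
    rewrite Scl //= (calg_assoc mS) // (calg_comm mS (eS i)) //.
    by rewrite -(calg_assoc mS) // ev.
  have ts' : m s' t \in Si i := idl _ _ s'S ti.
  have t's : m t' s \in Si i := idl _ _ t'S si.
  rewrite (aff_br aff) // (calg_comm mS tS s'S).
  by apply: (subvP (addvSl _ _)); rewrite memvB.
apply/J_invP => _ /mem_plusJP[s [t [si ti ->]]]; apply/mem_plusJP.
by exists (- t), s; rewrite memvN linearD /= JJ addrC.
Qed.

Lemma aff_summand_coord i j x : x \in bl j -> i != j -> br x (ew i) = 0.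
Proof.
move=> /mem_plusJP[s [t [sj tj ->]]] ij; have sS := Si_S sj; have tS := Si_S tj.
have := aff_br aff sS tS (eS i) (mem0v _).
rewrite linear0 addr0 (b0l mb) subr0 => ->.
rewrite (calg_comm mS) // -(Si_e tj) (calg_assoc mS) // (wedd_ee wS) (negPf ij).
exact: b0l.
Qed.

Lemma aff_summand_self i s t : s \in Si i -> t \in Si i -> br (s + J t) (ew i) = t.
Proof.
move=> si ti; have sS := Si_S si; have tS := Si_S ti.
have := aff_br aff sS tS (eS i) (mem0v _).
by rewrite linear0 addr0 (b0l mb) subr0 (calg_comm mS) // (Si_e ti).
Qed.

(* The opaque [I] keeps the canonical structures behind [directv] from
   unfolding the summands. *)
Lemma aff_summand_direct (I : 'I_n -> {vspace V}) :
  I =1 bl -> directv (\sum_i I i)%VS.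
Proof.
move=> IE; apply/directv_sumP => i _; apply/eqP; rewrite -subv0; apply/subvP => x.
rewrite memv_cap memv0 IE (eq_bigr bl) => [/andP[xi xj]|j _]; last exact: IE.
have cross z : z \in (\sum_(j | true && (j != i)) bl j)%VS -> br z (ew i) = 0.
  case/memv_sumP => v vj ->; rewrite (bsuml brb) big1 // => j /= ji.
  by apply: (@aff_summand_coord i j); [apply: vj | rewrite eq_sym].
have xe := cross _ xj.
have Jxe : br (J x) (ew i) = 0.
  apply: cross; move: xj => /memv_sumP[v vj ->]; rewrite linear_sum /=.
  apply: memv_sumr => j ji; have [_ _ /J_invP] := aff_summand_ideal j; apply.
  exact: vj.
move: xi xe Jxe => /mem_plusJP[s [t [si ti ->]]].
rewrite linearD /= JJ [_ - t]addrC !aff_summand_self ?memvN // => -> ->.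
by rewrite linear0 addr0.
Qed.

Lemma aff_summand_sum : (\sum_i bl i)%VS = fullv.
Proof.
apply/vspaceP => x; rewrite memvf; have [s [t [sS tS ->]]] := aff_full aff x.
rewrite (wspan_decomp mS wS sS) (wspan_decomp mS wS tS) linear_sum -big_split /=.
apply: memv_sumr => i _; apply/mem_plusJP.
have Sx u : u \in S -> m (ew i) u \in Si i.
  move=> uS; rewrite memSi Scl //= (calg_assoc mS) // (wedd_ee wS) !eqxx //.
by exists (m (ew i) s), (m (ew i) t); rewrite !Sx.
Qed.

(** The witness is the reflection 1 - 2 pi, where pi projects onto [P], spanned by the [yw i] and
    their images under [J], along [Q], built likewise from the [ew i]. Frames are X = [ew i], Y =
    [yw i]; a summand is aff(R) when [yw i = 0] and aff(C) otherwise. *)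
Lemma aff_involution_exists : exists s, is_aff_involution br J s.
Proof.
pose E := (\sum_i <[ew i]>)%VS; pose Y := (\sum_i <[yw i]>)%VS.
pose Q := (E + J @: E)%VS; pose P := (Y + J @: Y)%VS.
have eE i : ew i \in E.
  by apply: (subvP (sumv_sup i _ (subvv _))) => //; apply: memv_line.
have yY i : yw i \in Y.
  by apply: (subvP (sumv_sup i _ (subvv _))) => //; apply: memv_line.
have comp (w : 'I_n -> V) i x : (forall j, m (ew i) (w j) = if i == j then w i else 0) ->
    x \in (\sum_i <[w i]>)%VS -> m (ew i) x \in <[w i]>%VS.
  move=> ewj; case/memv_sumP => v vw ->; rewrite (bsumr mb); apply: memv_suml => j _.
  have /vlineP[a ->] := vw j isT; rewrite (bZr mb) memvZ // ewj.
  by case: eqP => _; rewrite ?memv_line ?mem0v.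
have ES x : x \in E -> x \in S.
  by apply/subvP; apply/subv_sumP => i _; rewrite -memvE.
have YS x : x \in Y -> x \in S.
  by apply/subvP; apply/subv_sumP => i _; rewrite -memvE.
have YE0 x : x \in Y -> x \in E -> x = 0.
  move=> xY xE; have xS := ES _ xE; rewrite (wspan_decomp mS wS xS) big1 // => i _.
  have /vlineP[a xa] := comp ew i x (fun j => wedd_ee wS i j) xE.
  have /vlineP[b xb] := comp yw i x (fun j => wedd_eyn mS wS i j) xY.
  have : a *: ew i + (- b) *: yw i = 0 by rewrite scaleNr -xa -xb subrr.
  by case/wedd_line0 => a0 _; rewrite xa a0 scale0r.
have PQ : (P :&: Q = 0)%VS.
  apply/eqP; rewrite -subv0; apply/subvP => x; rewrite memv_cap memv0.
  case/andP => /mem_plusJP[y1 [y2 [y1Y y2Y ->]]] /mem_plusJP[e1 [e2 [e1E e2E]]].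
  move/eqP; rewrite -subr_eq0 opprD addrACA -linearB => /eqP st0.
  have S1 : y1 - e1 \in S by apply: memvB; [apply: YS | apply: ES].
  have S2 : y2 - e2 \in S by apply: memvB; [apply: YS | apply: ES].
  have [/eqP d1 /eqP d2] := aff_coord0 S1 S2 st0.
  move: d1 d2; rewrite !subr_eq0 => /eqP y1e /eqP y2e.
  have y10 : y1 = 0 by apply: YE0 => //; rewrite y1e.
  have y20 : y2 = 0 by apply: YE0 => //; rewrite y2e.
  by rewrite y10 y20 linear0 addr0.
have QP : (Q :&: P = 0)%VS by rewrite capvC.
pose s : 'End(V) := (\1 - 2 *: daddv_pi P Q)%VF.
have sE x : s x = x - 2 *: daddv_pi P Q x.
  by rewrite add_lfunE opp_lfunE id_lfunE scale_lfunE.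
have sQ x : x \in Q -> s x = x.
  move=> xQ; rewrite sE; have xPQ : x \in (P + Q)%VS by apply: (subvP (addvSr _ _)).
  have /eqP := daddv_pi_add PQ xPQ; rewrite (daddv_pi_id QP xQ) -subr_eq0 addrK.
  by move/eqP->; rewrite scaler0 subr0.
have sP x : x \in P -> s x = - x.
  move=> xP; rewrite sE (daddv_pi_id PQ xP) scaler_nat mulr2n opprD addrA subrr.
  exact: add0r.
have memQ i : ew i \in Q /\ J (ew i) \in Q.
  by split; [apply: (subvP (addvSl _ _)) | apply: (subvP (addvSr _ _)); apply: memv_img].
have memP i : yw i \in P /\ J (yw i) \in P.
  by split; [apply: (subvP (addvSl _ _)) | apply: (subvP (addvSr _ _)); apply: memv_img].
have JXX i : br (J (ew i)) (ew i) = ew i.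
  by rewrite -[LHS]/(m (ew i) (ew i)) (wedd_ee wS) eqxx.
exists s, n, bl; split; [exact: aff_summand_direct (fun=> erefl) | exact: aff_summand_sum
  | exact: aff_summand_ideal | move=> i].
have free2 a b c d : a *: ew i + b *: J (ew i) + (c *: yw i + d *: J (yw i)) = 0 ->
    [/\ a = 0, b = 0, c *: yw i = 0 & d *: yw i = 0].
  rewrite addrACA -!linearZ -linearD => z0.
  have [||/wedd_line0[-> ->] /wedd_line0[-> ->] //] := aff_coord0 _ _ z0;
  by rewrite memvD ?memvZ.
case: (wedd_yy wS i) => [y0|y2]; [left | right].
  exists (ew i); rewrite !sQ; try by case: (memQ i).
  split=> //; split=> //; rewrite /basis_of /bl /Si y0 addv0 span_cons span_seq1.
  rewrite limg_line eqxx /=; apply/(freeP (X := [tuple ew i; J (ew i)])) => k /=.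
  rewrite !big_ord_recl big_ord0 addr0 /= => kz.
  have [|k0 k1 _ _] := free2 (k ord0) (k (lift ord0 ord0)) 0 0.
    by rewrite kz !scale0r !addr0.
  by move=> j; case: (unliftP ord0 j) => [l ->|->//]; rewrite (ord1 l).
have y0 : yw i != 0.
  apply: contraNneq (wedd_e0 wS i) => y0.
  by rewrite -oppr_eq0 -y2 y0 (b0l mb).
have JJ0 u v : u \in S -> v \in S -> br (J u) (J v) = 0.
  by move=> uS vS; have := aff_brJ uS (mem0v _) vS; rewrite add0r (b0r mb).
exists (ew i), (yw i); have [Qe QJe] := memQ i; have [Py PJy] := memP i.
rewrite (sQ _ Qe) (sQ _ QJe) (sP _ Py) (sP _ PJy); split=> //; split=> //.
- rewrite /basis_of /bl /Si !span_cons span_nil addv0 limgD !limg_line; apply/andP; split.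
    by apply/eqP; rewrite -!addvA; congr addv; rewrite !addvA; congr addv; rewrite addvC.
  apply/(freeP (X := [tuple ew i; J (ew i); yw i; J (yw i)])) => k /=.
  rewrite !big_ord_recl big_ord0 addr0 /= addrA => kz.
  have [k0 k1 k2 k3] := free2 _ _ _ _ kz.
  have sc c : c *: yw i = 0 -> c = 0.
    by move=> /eqP; rewrite scaler_eq0 (negPf y0) orbF => /eqP.
  move=> j; case: (unliftP ord0 j) => [{}j ->|->//].
  case: (unliftP ord0 j) => [{}j ->|->//].
  case: (unliftP ord0 j) => [{}j ->|->]; last exact: sc.
  by rewrite (ord1 j); apply: sc.
- by split; [apply: (wedd_ey wS) | rewrite -[LHS]/(m _ _) (calg_comm mS) // (wedd_ey wS)].
- by split; [exact: aff_brSS | exact: JJ0].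
Qed.

Lemma mean_curvature_affE : mean_curvature_ss br J = J e *+ 2.
Proof. exact: (mean_curvature_aff aff_involution_exists). Qed.

End Summands.

End AffineMeanCurvature.

(** * Subalgebras and the quotient by the abelian ideal *)

Section SubalgebraTransfer.
Variables (R : realType) (V : vectType R) (br : V -> V -> V) (J : 'End(V)).
Hypotheses (lieP : lie_bracket br) (cplxP : complex_structure br J).
Variable h : {vspace V}.
Hypothesis hsub : J_subalgebra br J h.

Let brb := lie_bilin lieP.

Lemma sub_brE x y : vsval (sub_br br (h := h) x y) = br (vsval x) (vsval y).
Proof.
rewrite vsprojK //; have [/(lie_spanP lieP) hcl _] := hsub.
by apply: hcl; apply: subvsP.
Qed.

Lemma sub_JE x : vsval (sub_J J h x) = J (vsval x).
Proof.
have [_ /J_invP hJ] := hsub.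
rewrite lfunE /= vsprojK // hJ //; exact: subvsP.
Qed.

Lemma sub_lie : lie_bracket (sub_br br (h := h)).
Proof.
split=> [y a x z|x a y z|x|x y z]; apply: subvs_inj.
- by rewrite sub_brE !linearP /= !sub_brE (bDl brb) (bZl brb).
- by rewrite sub_brE !linearP /= !sub_brE (bDr brb) (bZr brb).
- by rewrite sub_brE (lie_alt lieP).
by rewrite !linearD /= !sub_brE (lie_jacobi lieP).
Qed.

Lemma sub_cplx : complex_structure (sub_br br (h := h)) (sub_J J h).
Proof.
split=> [x|x y]; apply: subvs_inj.
  by rewrite !sub_JE (cplx_sqr cplxP) linearN.
rewrite linearB !linearD /= !(sub_brE, sub_JE).
exact: (cplx_integrable cplxP).
Qed.

End SubalgebraTransfer.

Section LeviTransfer.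
Variables (R : realType) (V : vectType R) (br : V -> V -> V) (J : 'End(V)).
Hypotheses (lieP : lie_bracket br) (cplxP : complex_structure br J).
Variables (B : {vspace V}) (n : nat) (ew yw : 'I_n -> V).
Local Notation m := (Jmul br J).
Local Notation S := (wspan ew yw).
Local Notation h := (levi J ew yw).
Hypotheses (mB : calg m B) (wB : wedderburn m B ew yw).
Hypothesis hsub : J_subalgebra br J h.
Hypothesis hbr : forall s t s' t', s \in S -> t \in S -> s' \in S -> t' \in S ->
  br (s + J t) (s' + J t') = m t s' - m t' s.

Let ew' i : subvs_of h := vsproj h (ew i).
Let yw' i : subvs_of h := vsproj h (yw i).
Let br' := sub_br br (h := h).
Let J' := sub_J J h.
Local Notation m' := (Jmul br' J').

Let Sh x : x \in S -> x \in h.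
Proof. exact/subvP/addvSl. Qed.

Let ewE i : vsval (ew' i) = ew i.
Proof. by rewrite vsprojK // Sh // mem_wspan_e. Qed.

Let ywE i : vsval (yw' i) = yw i.
Proof. by rewrite vsprojK // Sh // mem_wspan_y. Qed.

Let memS' x : (x \in wspan ew' yw') = (vsval x \in S).
Proof.
have img : (linfun vsval @: wspan ew' yw')%VS = S.
  rewrite /wspan limg_sum; apply: eq_bigr => i _.
  by rewrite limgD !limg_line !lfunE /= ewE ywE.
apply/idP/idP => [xS|]; first by rewrite -img -[vsval x]lfunE memv_img.
by rewrite -img => /memv_imgP[z zS]; rewrite lfunE /= => /subvs_inj ->.
Qed.

Let mE x y : vsval (m' x y) = m (vsval x) (vsval y).
Proof. by rewrite (sub_brE lieP hsub) (sub_JE hsub). Qed.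

(** [mean_curvature_ss] lives on a whole space, so the subalgebra [h] is first turned into an
    algebra of its own. *)
Lemma levi_aff : aff_wedderburn br' J' ew' yw'.
Proof.
have lie' : lie_bracket br' := sub_lie lieP hsub.
have mS := calg_wspan mB wB.
have mS' : calg m' (wspan ew' yw').
  split; first exact: m_bilin.
  - by move=> x y; rewrite !memS' mE; apply: (calg_closed mS).
  - move=> x y; rewrite !memS' => xS yS; apply: subvs_inj; rewrite !mE.
    exact: (calg_comm mS).
  move=> x y z; rewrite !memS' => xS yS zS; apply: subvs_inj; rewrite !mE.
  exact: (calg_assoc mS).
split=> //; first exact: (sub_cplx lieP cplxP hsub).
- split=> [i|i|i|i j|i|i|x xS].
  + exact: mem_wspan_e.
  + exact: mem_wspan_y.
  + by apply: contraNneq (wedd_e0 wB i) => e0; rewrite -ewE e0 linear0.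
  + by apply: subvs_inj; rewrite mE !ewE (wedd_ee wB); case: eqP; rewrite ?ewE ?linear0.
  + by apply: subvs_inj; rewrite mE ewE !ywE (wedd_ey wB).
  + case: (wedd_yy wB i) => [y0|y2]; [left | right]; apply: subvs_inj.
      by rewrite ywE y0 linear0.
    by rewrite mE !ywE y2 linearN /= ewE.
  by exists x => //; rewrite subrr; exists 0.
- move=> x; have /mem_plusJP[s [t [sS tS xE]]] := subvsP x.
  have sP := vsprojK (Sh sS); have tP := vsprojK (Sh tS).
  exists (vsproj h s), (vsproj h t); split; rewrite ?memS' ?sP ?tP //.
  by apply: subvs_inj; rewrite linearD /= (sub_JE hsub) sP tP.
move=> s t s' t'; rewrite !memS' => sS tS s'S t'S; apply: subvs_inj.
by rewrite (sub_brE lieP hsub) linearB !linearD /= !(sub_JE hsub) !mE hbr.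
Qed.

Lemma levi_mean_curvature :
  vsval (mean_curvature_ss br' J') = J (\sum_i ew i) *+ 2.
Proof.
rewrite (mean_curvature_affE levi_aff) raddfMn /= (sub_JE hsub) linear_sum /=.
by congr (J _ *+ 2); apply: eq_bigr => i _; apply: ewE.
Qed.

End LeviTransfer.

Section QuotientTransfer.
Variables (R : realType) (V : vectType R) (br : V -> V -> V) (J : 'End(V)).
Hypotheses (lieP : lie_bracket br) (cplxP : complex_structure br J).
Hypothesis solvP : two_step_solvable br.

Local Notation D := (derived br).
Local Notation I := (derivedJ br J).
Local Notation K := (derived_plus br J).
Local Notation Q := (quot K I).
Local Notation p := (quot_proj K I).
Local Notation qbr := (@quot_br R V br K I).
Local Notation qJ := (quot_J J K I).
Local Notation m := (Jmul br J).

Let brb := lie_bilin lieP.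

Lemma subv_plus x : x \in D -> x \in K.
Proof. exact/subvP/addvSl. Qed.

Lemma J_plus x : x \in K -> J x \in K.
Proof.
case/mem_plusJP => u [v [uD vD ->]]; apply/mem_plusJP; exists (- v), u.
by rewrite memvN linearD /= (JJ cplxP) addrC.
Qed.

Lemma derivedJ_plus x : x \in I -> x \in K.
Proof. by move/(subv_derivedJ cplxP)/subv_plus. Qed.

(** For x = u + J v, [u, i] vanishes and [J v, i] is [m v i]. This lets brackets on the quotient be
    computed on representatives. *)
Lemma br_plus_derivedJ x i : x \in K -> i \in I -> br x i \in I.
Proof.
move=> /mem_plusJP[u [v [uD vD ->]]] iI.
rewrite (bDl brb) (br_DD lieP solvP uD) ?add0r; last exact: (subv_derivedJ cplxP).
exact: (m_derivedJr lieP cplxP solvP).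
Qed.

Lemma quot_cap : ((K :\: I) :&: I)%VS = 0%VS. Proof. exact: capv_diff. Qed.

Lemma quot_val_plus (a : Q) : vsval a \in K.
Proof. exact: (subvP (diffvSl _ _) _ (subvsP a)). Qed.

Lemma quot_projK (a : Q) : p (vsval a) = a.
Proof.
by rewrite /quot_proj (daddv_pi_id quot_cap (subvsP a)) vsvalK.
Qed.

Lemma quot_proj_linear : linear p.
Proof. by move=> a x y; rewrite /quot_proj !linearP. Qed.

Lemma quot_projE x : linfun p x = p x.
Proof.
pose px := GRing.isLinear.Build R V Q *:%R p quot_proj_linear.
pose pL : {linear V -> Q} := HB.pack p px.
by rewrite -[p]/(pL : V -> Q) lfunE.
Qed.

Lemma quot_projB x y : p (x - y) = p x - p y.
Proof. by rewrite -!quot_projE linearB. Qed.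

Lemma quot_projD x y : p (x + y) = p x + p y.
Proof. by rewrite -!quot_projE linearD. Qed.

Lemma quot_val_proj x : x \in K -> x - vsval (p x) \in I.
Proof.
move=> xK; have xKI : x \in ((K :\: I) + I)%VS.
  by rewrite addv_diff; apply: (subvP (addvSl _ _)).
rewrite /quot_proj vsprojK ?memv_pi // -{1}(daddv_pi_add quot_cap xKI) addrC addKr.
exact: memv_pi.
Qed.

Lemma quot_proj0 x : x \in K -> (p x = 0) <-> (x \in I).
Proof.
move=> xK; split=> [px|xI].
  by have := quot_val_proj xK; rewrite px [vsval _]linear0 subr0.
have := memvB xI (quot_val_proj xK); rewrite opprB addrC subrK => pI.
apply: subvs_inj; rewrite linear0; apply/eqP.
by rewrite -memv0 -quot_cap memv_cap pI andbT; apply: subvsP.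
Qed.

Lemma quot_proj_eq x y : x \in K -> x - y \in I -> p x = p y.
Proof.
move=> xK xyI; apply/eqP; rewrite -subr_eq0 -quot_projB; apply/eqP.
by apply/quot_proj0 => //; apply: derivedJ_plus.
Qed.

Lemma quot_brE x y : x \in K -> y \in K -> qbr (p x) (p y) = p (br x y).
Proof.
move=> xK yK; rewrite /quot_br; symmetry; apply: quot_proj_eq.
  exact/subv_plus/br_derived.
set x' := vsval (p x); set y' := vsval (p y).
have -> : br x y - br x' y' = br x (y - y') - br y' (x - x').
  rewrite !(bBr brb) (br_anti lieP y' x) (br_anti lieP y' x') opprD !opprK.
  by rewrite addrA subrK.
by apply: memvB; apply: br_plus_derivedJ => //; [|exact: quot_val_plus|];
   apply: quot_val_proj.
Qed.

Lemma quot_JE x : x \in K -> qJ (p x) = p (J x).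
Proof.
move=> xK.
have lin : linear (p \o J \o vsval : Q -> Q).
  by move=> a u v; rewrite /= !linearP quot_proj_linear.
pose fx := GRing.isLinear.Build R Q Q *:%R (p \o J \o vsval) lin.
pose fL : {linear Q -> Q} := HB.pack (p \o J \o vsval : Q -> Q) fx.
have -> : qJ (p x) = p (J (vsval (p x))).
  by rewrite /quot_J -[_ \o _ \o _]/(fL : Q -> Q) lfunE.
symmetry; apply: quot_proj_eq; first exact: J_plus.
by rewrite -linearB; apply: (J_derivedJ cplxP); apply: quot_val_proj.
Qed.

Lemma quot_repr (a : Q) : exists2 x, x \in K & a = p x.
Proof. by exists (vsval a); [exact: quot_val_plus | rewrite quot_projK]. Qed.

Let brK x y : br x y \in K. Proof. exact/subv_plus/br_derived. Qed.

Lemma quot_lie : lie_bracket qbr.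
Proof.
split=> [b a x z|b a x z|x|x y z].
- have [u uK ->] := quot_repr x; have [v vK ->] := quot_repr z.
  have [w wK ->] := quot_repr b; rewrite -quot_proj_linear !quot_brE ?memvD ?memvZ //.
  by rewrite (bDl brb) (bZl brb) quot_proj_linear.
- have [u uK ->] := quot_repr x; have [v vK ->] := quot_repr z.
  have [w wK ->] := quot_repr b; rewrite -quot_proj_linear !quot_brE ?memvD ?memvZ //.
  by rewrite (bDr brb) (bZr brb) quot_proj_linear.
- have [u uK ->] := quot_repr x; rewrite quot_brE // (lie_alt lieP).
  by apply/quot_proj0; rewrite mem0v.
have [u uK ->] := quot_repr x; have [v vK ->] := quot_repr y.
have [w wK ->] := quot_repr z; rewrite !quot_brE //.
by rewrite -!quot_projD (lie_jacobi lieP); apply/quot_proj0; rewrite mem0v.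
Qed.

Lemma quot_cplx : complex_structure qbr qJ.
Proof.
split=> [x|x y].
  have [u uK ->] := quot_repr x.
  by rewrite !quot_JE ?J_plus // (JJ cplxP) -!quot_projE linearN.
have [u uK ->] := quot_repr x; have [v vK ->] := quot_repr y.
have JuK := J_plus uK; have JvK := J_plus vK.
rewrite (quot_JE uK) (quot_JE vK) !quot_brE //.
rewrite !quot_JE //.
rewrite -!(quot_projD, quot_projB) (cplx_integrable cplxP).
by apply/quot_proj0; rewrite mem0v.
Qed.

Lemma quot_derivedP a : a \in derived qbr -> exists2 u, u \in D & a = p u.
Proof.
have : (derived qbr <= linfun p @: D)%VS.
  apply/(lie_spanP quot_lie) => x y _ _; have [u uK ->] := quot_repr x.
  have [v vK ->] := quot_repr y; rewrite quot_brE // -quot_projE memv_img //.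
  exact: br_derived.
by move/subvP => H /H /memv_imgP[u uD ->]; exists u; rewrite // quot_projE.
Qed.

Lemma quot_two_step : two_step_solvable qbr.
Proof.
apply/eqP; rewrite -subv0; apply/(lie_spanP quot_lie) => x y.
move=> /quot_derivedP[u uD ->] /quot_derivedP[v vD ->].
rewrite quot_brE ?subv_plus // (br_DD lieP solvP) // memv0; apply/eqP.
by apply/quot_proj0; rewrite mem0v.
Qed.

(** If J (p u) = p w with [u], [w] in [D], then J u - w is in [I], so [J u] is in [D] and [u] in
    [I]. In the quotient, congruences modulo [I] thus become equalities. *)
Lemma quot_derivedJ0 : derivedJ qbr qJ = 0%VS.
Proof.
apply/eqP; rewrite -subv0; apply/subvP => a; rewrite (mem_derivedJ quot_cplx).
case/andP => /quot_derivedP[u uD ->]; rewrite quot_JE ?subv_plus //.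
case/quot_derivedP => w wD /eqP; rewrite -subr_eq0 -quot_projB => /eqP.
have uK := subv_plus uD; have wK := subv_plus wD.
move/(quot_proj0 _).1; rewrite memvB ?J_plus // => /(_ isT) JuwI.
rewrite memv0; apply/eqP/quot_proj0 => //; rewrite (mem_derivedJ cplxP) uD /=.
by rewrite -[J u](subrK w) memvD //; apply: (subv_derivedJ cplxP).
Qed.

Lemma quot_mE x y : x \in K -> y \in K -> Jmul qbr qJ (p x) (p y) = p (m x y).
Proof. by move=> xK yK; rewrite /Jmul quot_JE // quot_brE // J_plus. Qed.

Lemma quot_iter_sq j x : x \in K ->
  iter j (sq (Jmul qbr qJ)) (p x) = p (iter j (sq m) x).
Proof.
move=> xK; have itK k : iter k (sq m) x \in K by case: k => // k; apply: brK.
by elim: j => //= j ->; rewrite /sq quot_mE.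
Qed.

End QuotientTransfer.

Lemma Spec_restr_end (R : realType) (V : vectType R) (W : {vspace V}) (f : 'End(V))
    (a : R) x :
  x \in W -> x != 0 -> f x = a *: x -> Spec (restr_end W f) (real_complex R a).
Proof.
move=> xW x0 fx; rewrite /Spec /= eigenvalue_map; apply/eigenvalueP.
exists (rVof (vbasis fullv) (vsproj W x)).
  rewrite /endo_mx -rVof_app ?vbasisP // -linearZ; congr rVof.
  by rewrite /restr_end lfunE /= vsprojK // fx linearZ.
rewrite rVof_eq0 ?vbasisP //; apply: contraNneq x0 => x0.
by rewrite -(vsprojK xW) x0 linear0.
Qed.

(** * From the spectral hypothesis to the adapted idempotent *)

Section MeanCurvatureVector.
Variables (R : realType) (V : vectType R) (br : V -> V -> V) (J : 'End(V)).
Variable JU : V.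
Hypotheses (lieP : lie_bracket br) (cplxP : complex_structure br J).
Hypothesis solvP : two_step_solvable br.
Hypothesis mcP : is_mean_curvature br J JU.

Local Notation D := (derived br).
Local Notation I := (derivedJ br J).
Local Notation K := (derived_plus br J).
Local Notation p := (quot_proj K I).
Local Notation qbr := (@quot_br R V br K I).
Local Notation qJ := (quot_J J K I).
Local Notation m := (Jmul br J).
Local Notation qm := (Jmul qbr qJ).

Let brb := lie_bilin lieP.
Let mb := m_bilin J lieP.
Let qlie := quot_lie lieP cplxP solvP.
Let qcplx := quot_cplx lieP cplxP solvP.
Let qsolv := quot_two_step lieP cplxP solvP.
Let qI0 := quot_derivedJ0 lieP cplxP solvP.
Let brD := br_derived lieP.

Lemma quot_calg : calg qm (derived qbr).
Proof.
have diff0 x y : x - y \in derivedJ qbr qJ -> x = y.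
  by rewrite qI0 memv0 subr_eq0 => /eqP.
split; first exact: m_bilin.
- by move=> x y _ _; apply: (br_derived qlie).
- by move=> x y xD yD; apply/diff0/(mD_derivedJ qlie qcplx).
by move=> x y z xD yD zD; apply/diff0/(m_assoc_mod qlie qcplx qsolv).
Qed.

(** In the quotient the analogue of [I] is zero, so the unit [eq] of the Wedderburn part meets the
    requirements of [levi_exists_unique]. This identifies the subalgebra chosen by [J_levi], its
    mean curvature vector is 2 J eq, and [e0] lifts [eq]. *)
Lemma mean_curvature_lift : exists e0,
  [/\ e0 \in D, JU - J e0 *+ 2 \in I, m e0 e0 - e0 \in I &
   forall x, x \in D -> m e0 x \in I -> exists j, iter j (sq m) x \in I].
Proof.
have [n [ew [yw wq]]] := wedderburn_exists quot_calg.
pose eq := \sum_i ew i.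
have eqD : eq \in derived qbr by apply: memv_suml => i _; apply: (wedd_eB wq).
have eqeq : qm eq eq = eq by apply/(wspan_unit quot_calg wq)/wedd_unitB.
have eqI i : i \in derivedJ qbr qJ -> qm eq i = i -> i = 0.
  by rewrite qI0 memv0 => /eqP.
have eqN x : x \in derived qbr -> qm eq x \in derivedJ qbr qJ ->
    exists j, iter j (sq qm) x \in derivedJ qbr qJ.
  rewrite qI0 memv0 => xD /eqP ex.
  have [j xj] := wedd_nil quot_calg wq xD ex.
  by exists j; rewrite xj mem0v.
have calgq := calgG qlie qcplx qsolv eqI.
have [n' [ew' [yw' [wG eqE ss sd uniq]]]] :=
  levi_exists_unique qlie qcplx qsolv eqD eqeq eqI eqN.
have hqE : J_levi qbr qJ = levi qJ ew' yw'.
  rewrite /J_levi; set X := (X in xget _ X).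
  have [_] : X (xget 0%VS X) by apply: xgetPex; exists (levi qJ ew' yw').
  exact: uniq.
have hsub : J_subalgebra qbr qJ (levi qJ ew' yw') by case: sd.
have hbr := @levi_br _ _ _ _ qlie qcplx qsolv eq eqI n' ew' yw' wG.
have [JUK] := mcP; rewrite hqE (levi_mean_curvature qlie qcplx calgq wG hsub hbr).
rewrite -eqE => pJU.
have [e0 e0D eqp] := quot_derivedP lieP cplxP solvP eqD.
have e0K := subv_plus J e0D; have Je0K := J_plus cplxP e0K.
have mK x y : m x y \in K by apply: subv_plus; apply: brD.
exists e0; split=> //.
- apply/quot_proj0; first by rewrite memvB // mulr2n memvD.
  rewrite quot_projB pJU eqp (quot_JE cplxP) // mulr2n mulr2n quot_projD.
  exact: subrr.
- apply/quot_proj0; first by rewrite memvB.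
  by rewrite quot_projB -(quot_mE lieP cplxP solvP) // -eqp eqeq subrr.
(* [derived qbr] comes from brackets within g' + J g' and need not contain the image of [x]; it
   contains that of [m x x], at the price of one more squaring. *)
move=> x xD ex; have xK := subv_plus J xD; have xxD : m x x \in D by apply: brD.
have exx : qm eq (p (m x x)) = 0.
  rewrite eqp (quot_mE lieP cplxP solvP) //; apply/quot_proj0 => //.
  by rewrite (mD_CA J lieP solvP) //; apply: (m_derivedJr lieP cplxP solvP).
have pxxD : p (m x x) \in derived qbr.
  by rewrite -(quot_mE lieP cplxP solvP) //; apply: (br_derived qlie).
have [j] := wedd_nil quot_calg wq pxxD exx.
rewrite (quot_iter_sq lieP cplxP solvP) // -[m x x]/(sq m x) -iterSr => pj.
exists j.+1; apply/quot_proj0 => //.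
exact: mK.
Qed.

Hypothesis specP : ~ Spec (restr_end I (ad br JU)) (2 : R[i]).

(** On [I] the operator [ad JU] is twice [m e0], so a nonzero fixed vector of [m e0] would give the
    eigenvalue 2. Hence [m e0 i - i = m e0 e0 - e0] is solvable in [I], and [e0 - i] is idempotent
    because [m i] vanishes on [D]. *)
Lemma adapted_unit_exists : exists e, [/\ e \in D, m e e = e,
  forall i, i \in I -> m e i = i -> i = 0 &
  forall x, x \in D -> m e x \in I -> exists j, iter j (sq m) x \in I].
Proof.
have [e0 [e0D JUe e0e e0N]] := mean_curvature_lift.
have ID := @subv_derivedJ _ _ br _ cplxP.
have e0I i : i \in I -> m e0 i = i -> i = 0.
  move=> iI ei; apply/eqP/negPn/negP => i0; apply: specP.
  rewrite -(rmorph_nat (real_complex R)); apply: (Spec_restr_end iI i0).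
  rewrite (lmulE brb) -[JU](subrK (J e0 *+ 2)) (bDl brb).
  rewrite (br_DD lieP solvP (ID _ JUe) (ID _ iI)) add0r mulr2n (bDl brb).
  by rewrite -/(m e0 i) ei scaler_nat mulr2n.
have [i iI iE] := subI lieP cplxP solvP e0D e0I e0e.
have eD : e0 - i \in D by rewrite memvB // ID.
have mE x : x \in D -> m (e0 - i) x = m e0 x.
  by move=> xD; rewrite (bBl mb) (m_derivedJl lieP cplxP solvP iI xD) subr0.
exists (e0 - i); split=> //.
- rewrite mE // (bBr mb); move/eqP: iE; rewrite subr_eq => /eqP->.
  by rewrite addrAC [_ - i - _]addrAC subrr add0r addrC.
- by move=> k kI; rewrite mE ?ID //; apply: e0I.
by move=> x xD; rewrite mE //; apply: e0N.
Qed.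

End MeanCurvatureVector.

Theorem theorem2 (R : realType) (g : vectType R) (br : g -> g -> g)
    (J : 'End(g)) (JU : g) :
  lie_bracket br ->
  complex_structure br J ->
  two_step_solvable br ->
  is_mean_curvature br J JU ->
  ~ Spec (restr_end (derivedJ br J) (ad br JU)) (2 : R[i]) ->
  exists! h : {vspace g}, J_semisimple br J h /\ semidirect br J h (Rad br J).
Proof.
move=> lieP cplxP solvP mcP specP.
have [e [eD ee eI eN]] := adapted_unit_exists lieP cplxP solvP mcP specP.
have [n [ew [yw [_ _ ss sd uniq]]]] := levi_exists_unique lieP cplxP solvP eD ee eI eN.
by exists (levi J ew yw); split=> // h [_ /uniq].
Qed.
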